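(* For $m\in\mathbb{N}$, $n\in\mathbb{N}$, $N\in\{0,1,2,\ldots\}$, and $p\in[1,\infty]$, $$\mathcal{C}_0\left(\mathcal{P}_{n,m},L_p(\mathfrak{B}^m),\Delta^N\right)=\left(\frac{2}{|S^{m-1}|_{m-1}}\right)^{1/p}\mathcal{C}_0\left(\mathcal{P}_{2\lfloor n/2\rfloor,1,e},\,L_{p,|t|^{m-1}}([-1,1]),\,(Be_{m/2-1})^N\right).$$
   Context: Sharp constant: for a space $\mathcal{B}\ne\{0\}$ of functions on $\Omega$ lying in a (quasi)normed function space $F(\Omega)$, a linear operator $D$ on $\mathcal{B}$, and $a\in\Omega$, $\mathcal{C}_a(\mathcal{B},F(\Omega),D):=\sup_{f\in\mathcal{B}\setminus\{0\}}|D(f)(a)|/\|f\|_{F(\Omega)}$. $\mathfrak{B}^m=\{x\in\mathbb{R}^m:|x|\le1\}$ is the closed unit ball, $L_p(\mathfrak{B}^m)$ is the usual complex $L_p$ space with Lebesgue measure. $|S^{m-1}|_{m-1}=2\pi^{m/2}/\Gamma(m/2)$ for $m\ge2$ and $|S^0|_0=2$. $1/p:=0$ for $p=\infty$. $\mathcal{P}_{n,m}$ is the set of polynomials $\sum_{|\alpha|\le n}c_\alpha x^\alpha$ in $m$ real variables with complex coefficients of total degree at most $n$ (restricted to the given domain). $\mathcal{P}_{n,1,e}$ is the set of even univariate polynomials in $\mathcal{P}_{n,1}$ (restricted to $[-1,1]$). For a weight $\mu\ge0$ on $\Omega_1\subseteq\mathbb{R}$, $\|f\|_{L_{p,\mu(t)}(\Omega_1)}=\left(\int_{\Omega_1}|f(t)|^p\mu(t)\,dt\right)^{1/p}$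 for $0<p<\infty$, and $\|f\|_{L_{\infty,\mu(t)}(\Omega_1)}=\operatorname{ess\,sup}_{\Omega_1}|f|$. $\Delta=\sum_{j=1}^m\partial^2/\partial x_j^2$ is the Laplace operator. The Bessel operator is $Be_\nu(\varphi)(r)=\varphi''(r)+\frac{2\nu+1}{r}\varphi'(r)$, $\nu\ge-1/2$, with $Be_\nu(\varphi)(0):=\lim_{r\to0}Be_\nu(\varphi)(r)$. For $N=0$, $\Delta^N$ and $(Be_\nu)^N$ are the identity (imbedding) operators. *)

(* Defs.v *)
From HB Require Import structures.
From mathcomp Require Import all_boot all_order all_algebra.
From mathcomp Require Import all_classical all_reals all_analysis.
From mathcomp Require Import ess_sup_inf.
From mathcomp Require Export complex.

Set Implicit Arguments.
Unset Strict Implicit.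
Unset Printing Implicit Defensive.
Import Order.TTheory GRing.Theory Num.Theory.
Import numFieldNormedType.Exports.

Local Open Scope classical_set_scope.
Local Open Scope ring_scope.

(* Lebesgue measure on R^m, carried by [m.-tuple R]: the Dirac measure on the
   one-point space R^0, then the image of the product of [lebesgue_measure] on
   R and of the Lebesgue measure on R^m under (x, t) |-> x :: t. *)

Definition tuple_cons (R : Type) (k : nat) (z : R * k.-tuple R) :
  k.+1.-tuple R := [tuple of z.1 :: z.2].

Lemma measurable_tuple_cons (R : realType) (k : nat) :
  measurable_fun [set: measurableTypeR R * k.-tuple (measurableTypeR R)]
    (@tuple_cons (measurableTypeR R) k).
Proof. exact: measurable_cons. Qed.

Section lebesgue_step.
Context (R : realType) (k : nat).
Variable mu : {sigma_finite_measure set (k.-tuple (measurableTypeR R)) -> \bar R}.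

Definition lebesgue_step : set (k.+1.-tuple (measurableTypeR R)) -> \bar R :=
  pushforward (@lebesgue_measure R \x mu)%E (@tuple_cons (measurableTypeR R) k).

Let step0 : lebesgue_step set0 = 0%E.
Proof. by rewrite /lebesgue_step /pushforward preimage_set0 measure0. Qed.

Let step_ge0 A : (0 <= lebesgue_step A)%E.
Proof. by rewrite /lebesgue_step /pushforward; exact: measure_ge0. Qed.

Let step_sigma_additive : semi_sigma_additive lebesgue_step.
Proof.
have mf := @measurable_tuple_cons R k.
move=> F mF tF mUF; rewrite /lebesgue_step /pushforward preimage_bigcup.
apply: measure_semi_sigma_additive.
- by move=> n; rewrite -[X in measurable X]setTI; exact: mf.
- apply/trivIsetP => /= i j _ _ ij; rewrite -preimage_setI.
  by move/trivIsetP : tF => /(_ _ _ _ _ ij) ->//; rewrite preimage_set0.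
- by rewrite -preimage_bigcup -[X in measurable X]setTI; exact: mf.
Qed.

HB.instance Definition _ := isMeasure.Build _ _ _ lebesgue_step
  step0 step_ge0 step_sigma_additive.

Let step_sigma_finite : sigma_finite setT lebesgue_step.
Proof.
have /sigma_finiteP[F [FT ndF Foo]] := sigma_finiteT (@lebesgue_measure R).
have /sigma_finiteP[G [GT ndG Goo]] := sigma_finiteT mu.
pose g (t : k.+1.-tuple (measurableTypeR R)) := (tnth t ord0, [tuple of behead t]).
have mg : measurable_fun setT g.
  by apply/measurable_fun_pair; [exact: measurable_tnth|exact: measurable_behead].
exists (fun i => g @^-1` (F i `*` G i)).
  apply/seteqP; split => // t _.
  have [i _ Fi] : (\bigcup_i F i) (g t).1 by rewrite -FT.
  have [j _ Gj] : (\bigcup_i G i) (g t).2 by rewrite -GT.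
  exists (maxn i j) => //; split.
    by move: Fi; exact/subsetPset/ndF/leq_maxl.
  by move: Gj; exact/subsetPset/ndG/leq_maxr.
move=> i; have [mF Fi] := Foo i; have [mG Gi] := Goo i; split.
  by rewrite -[X in measurable X]setTI; apply: mg => //; exact: measurableX.
rewrite /lebesgue_step /pushforward -comp_preimage.
rewrite (_ : g \o _ = id).
  by rewrite preimage_id product_measure1E// lte_mul_pinfty// ge0_fin_numE.
by apply/funext => -[x t] /=; rewrite /g; congr pair; exact/val_inj.
Qed.

HB.instance Definition _ := Measure_isSigmaFinite.Build _ _ _
  lebesgue_step step_sigma_finite.

End lebesgue_step.

Section dirac_tuple0.
Context (R : realType).

Definition lebesgue_tuple0 : set (0.-tuple (measurableTypeR R)) -> \bar R :=
  dirac ([tuple] : 0.-tuple (measurableTypeR R)).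

HB.instance Definition _ := Measure.on lebesgue_tuple0.

Let tuple0_sigma_finite : sigma_finite setT lebesgue_tuple0.
Proof.
apply: fin_num_fun_sigma_finite => [|A mA]; first by rewrite measure0.
by rewrite /lebesgue_tuple0 diracE.
Qed.

HB.instance Definition _ := Measure_isSigmaFinite.Build _ _ _
  lebesgue_tuple0 tuple0_sigma_finite.

End dirac_tuple0.

Fixpoint lebesgue_tuple (R : realType) (m : nat) :
    {sigma_finite_measure set (m.-tuple (measurableTypeR R)) -> \bar R} :=
  match m return {sigma_finite_measure set (m.-tuple (measurableTypeR R)) -> \bar R} with
  | 0 => @lebesgue_tuple0 R
  | k.+1 => lebesgue_step (lebesgue_tuple R k)
  end.

Lemma lebesgue_tuple_box (R : realType) (m : nat) (A : 'I_m -> set R) :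
  (forall i, measurable (A i)) ->
  lebesgue_tuple R m [set t | forall i, A i (tnth t i)] =
  (\prod_(i < m) lebesgue_measure (A i))%E.
Proof.
elim: m A => [|k IH] A mA /=.
  rewrite big_ord0 /lebesgue_tuple0 diracE mem_set//.
  by move=> [].
rewrite /lebesgue_step /pushforward big_ord_recl -IH; last by move=> i; exact: mA.
rewrite -product_measure1E; [|exact: mA|]; last first.
  rewrite (_ : [set _ | _] = \bigcap_(i in [set: 'I_k])
     ((fun t => tnth t i) @^-1` A (lift ord0 i))); last first.
    by apply/seteqP; split => t /= H i; [move=> _; exact: H|exact: H].
  apply: fin_bigcap_measurable => [|i _]; first exact: finite_finset.
  by rewrite -[X in measurable X]setTI; apply: measurable_tnth => //; exact: mA.
congr (product_measure1 _ _ _); apply/seteqP; split => -[x t] /=.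
  move=> H; split; first by have := H ord0; rewrite tnth0.
  by move=> i; have := H (lift ord0 i); rewrite tnthS.
move=> [Ax At] i; case: (unliftP ord0 i) => [j ->|->]; last by rewrite tnth0.
by rewrite tnthS; exact: At.
Qed.

(* The tuple model carries the measure, the row-vector model carries the
   differential calculus. *)
Definition row_of_tuple (R : Type) (m : nat) (t : m.-tuple R) : 'rV[R]_m :=
  \row_i tnth t i.

(* The norm [`|x|] of the library on ['rV[R]_m] is the sup norm. *)
Definition euclidean_norm (R : rcfType) (m : nat) (x : 'rV[R]_m) : R :=
  Num.sqrt (\sum_i x 0 i ^+ 2).

Definition unit_ball (R : rcfType) (m : nat) : set 'rV[R]_m :=
  [set x | euclidean_norm x <= 1].

(* In the two norms below, |f| is extended by 0 outside the domain, which
   changes neither the integral nor the essential supremum. *)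

Definition ball_Lp_norm (R : realType) (m : nat) (p : \bar R)
    (f : 'rV[R]_m -> R[i]) : \bar R :=
  Lnorm (lebesgue_tuple R m) p
    ((fun x => (\1_(@unit_ball R m) x * Normc.normc (f x))%:E) \o
     @row_of_tuple R m).

(* For p = +oo the weight is ignored.  The value for p = -oo is junk. *)
Definition weighted_Lp_norm (R : realType) (w : R -> R) (D : set R)
    (p : \bar R) (f : R -> R[i]) : \bar R :=
  match p with
  | r%:E =>
    ((\int[lebesgue_measure]_(t in D) (Normc.normc (f t) `^ r * w t)%:E)
       `^ r^-1)%E
  | +oo%E =>
    ess_sup lebesgue_measure (fun t => (\1_D t * Normc.normc (f t))%:E)
  | -oo%E => 0%E
  end.

(* Spaces of functions on a domain [Om] are represented by sets of functions on
   the ambient space; such a function is the zero function when it vanishes on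
   [Om]. *)
Definition sharp_constant (R : realType) (T : Type) (Om : set T)
    (B : set (T -> R[i])) (nrm : (T -> R[i]) -> \bar R)
    (D : (T -> R[i]) -> (T -> R[i])) (a : T) : \bar R :=
  ereal_sup [set ((Normc.normc (D f a))%:E / nrm f)%E | f in
    [set f | B f /\ exists2 x, Om x & f x != 0]].

(* A multi-index of length at most n has all its entries in {0, .., n}. *)
Definition mpoly_funs (R : rcfType) (n m : nat) : set ('rV[R]_m -> R[i]) :=
  [set f | exists c : {ffun 'I_m -> 'I_n.+1} -> R[i], f = fun x : 'rV[R]_m =>
     \sum_(a : {ffun 'I_m -> 'I_n.+1} | (\sum_i a i <= n)%N)
       c a * \prod_i (x 0 i)%:C%C ^+ a i].

Definition even_poly_funs (R : rcfType) (n : nat) : set (R -> R[i]) :=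
  [set f | (exists2 P : {poly R[i]}, (size P <= n.+1)%N &
     f = fun t => P.[t%:C%C]) /\ (forall t, f (- t) = f t)].

(* The complex-linear extension of an operator on real-valued functions. *)
Definition complexify (R : Type) (T : Type) (D : (T -> R) -> (T -> R))
    (f : T -> R[i]) : T -> R[i] :=
  fun x => (D (fun y => complex.Re (f y)) x +i*
            D (fun y => complex.Im (f y)) x)%C.

Definition laplacian (R : realType) (m : nat) (f : 'rV[R]_m -> R) :
    'rV[R]_m -> R :=
  fun x => \sum_(j < m) 'D_(delta_mx 0 j) ('D_(delta_mx 0 j) f) x.

Definition bessel (R : realType) (nu : R) (phi : R -> R) : R -> R :=
  let be r := derive1n 2 phi r + (2 * nu + 1) / r * derive1 phi r in
  fun r => if r == 0 then lim (be s @[s --> 0^']) else be r.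

Definition Gamma (R : realType) (s : R) : R :=
  \int[lebesgue_measure]_(t in `]0, +oo[) (t `^ (s - 1) * expR (- t)).

(* |S^(m-1)|_(m-1), for m >= 1. *)
Definition sphere_area (R : realType) (m : nat) : R :=
  if m == 1%N then 2 else 2 * pi `^ (m%:R / 2) / Gamma (m%:R / 2).

(* Main.v *)
(* Averaging over the sphere turns a polynomial f of degree at most n into an
   even univariate polynomial F of degree at most 2 * n./2, where F(r) is the
   mean of f(r theta); it does not increase the L_p norms, up to the factor
   that polar coordinates produce, and it carries Delta^N f(0) to
   Be^N F(0). Conversely F(|x|) is a polynomial with the same norm as F, again
   up to that factor.

   The sphere is never used: theta is the direction Y / |Y| of a Gaussian
   vector Y, and the polar formula
     int_0^oo E[g(r theta)] r^(m-1) dr = (1 / |S|) int g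
   follows from Tonelli's theorem and the scaling of Lebesgue measure alone.
   The norm and the direction of Y being independent, a spherical moment is the
   quotient of a moment of Y by a moment of |Y|; the Gaussian recurrence
   E[y^(a+2)] = (a+1)/2 E[y^a] then matches the Laplace and Bessel operators. *)

Require Import Defs.
From mathcomp Require Import all_boot all_order all_algebra.
From mathcomp Require Import all_classical all_reals all_analysis.
From mathcomp Require Import measurable_realfun ess_sup_inf zify ring lra.

Set Implicit Arguments.
Unset Strict Implicit.
Unset Printing Implicit Defensive.
Import Order.TTheory GRing.Theory Num.Theory.
Import numFieldNormedType.Exports.

Local Open Scope classical_set_scope.
Local Open Scope ring_scope.

(** * Scaling and polar coordinates *)

(** At the origin both operators read off one homogeneous layer. If Y has density proportional to
    exp(-|y|^2), each coordinate has variance 1/2 and E f(Y) is exp(Delta/4) f at 0. This suggests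
    Delta^N f(0) = 4^N N! E[f_2N(Y)], with f_2N the part of degree 2N, a formula then verified by
    induction on N. The Bessel operator is the radial part of Delta, so Be^N F(0) is 4^N N!
    E[|Y|^(2N)] times the coefficient of r^(2N) in F. The two values agree once that coefficient is
    the spherical mean of f_2N.

    The factor 2/|S| has two sources: 1/|S| comes from polar coordinates, 2 from folding [-1,1] onto
    the positive radii. The assumption p >= 1 enters through Jensen's inequality.

    Two obstacles remain. Values are complex while the differential operators act on real functions,
    so each polynomial is carried as a pair of real ones. And the average of a nonzero f may vanish
    identically: it is then no competitor in the second supremum, but the numerator attached to f is
    zero as well. *)

Section scaling.
Context {R : realType}.
Local Notation mu := (@lebesgue_measure R).

Lemma measurable_scale (c : R) :
  measurable_fun setT ((fun x => c * x) : measurableTypeR R -> measurableTypeR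
    R).
Proof. exact: measurable_funM. Qed.

(** By uniqueness of Lebesgue measure it suffices to compare both sides on the intervals []a, b]],
    whose preimages are [](a / c), (b / c)]]. *)
Lemma lebesgue_measure_scale (c : R) (A : set (measurableTypeR R)) : 0 < c ->
  measurable A ->
  (mu A = c%:E * pushforward mu (fun x : measurableTypeR R => c * x)%R A)%E.
Proof.
move=> c0 mA.
pose c' := NngNum (ltW c0).
pose nu : {measure set (measurableTypeR R) -> \bar R} :=
  mscale c' (pushforward mu ((fun x => c * x) : measurableTypeR R ->
    measurableTypeR R)).
change (mu A = nu (measurable_scale c) A); apply: lebesgue_measure_unique => //.
move=> _ [[a b]] _ <-;
  change (mu `]a, b] = c%:E * mu ((fun x : R => c * x)%R @^-1` `]a, b]))%E.
have -> : (fun x : R => c * x)%R @^-1` `]a, b] = `](a / c), (b / c)]%classic.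
  apply/seteqP; split => x /=; rewrite !in_itv/= ltr_pdivrMr// ler_pdivlMr//;
  by rewrite [x * c]mulrC.
rewrite !lebesgue_measure_itv/= !lte_fin ltr_pM2r ?invr_gt0//.
case: ifPn => // _; last by rewrite mule0.
by rewrite -!EFinD -EFinM; congr EFin; field; rewrite gt_eqF.
Qed.

Local Open Scope ereal_scope.
Lemma ge0_integral_scale (c : R) (f : R -> \bar R) : (0 < c)%R ->
  measurable_fun [set: measurableTypeR R] f -> (forall x, 0 <= f x) ->
  \int[mu]_x f (c * x)%R = c^-1%:E * \int[mu]_x f x.
Proof.
move=> c0 mf f0.
pose c' := NngNum (ltW c0).
pose pf : {measure set (measurableTypeR R) -> \bar R} := 
   pushforward mu ((fun x => c * x)%R : measurableTypeR R -> measurableTypeR R).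
rewrite [in RHS](@eq_measure_integral _ _ _ _ (mscale c' (pf (measurable_scale
  c)))); last first.
  by move=> A mA _; exact: lebesgue_measure_scale.
rewrite ge0_integral_mscale//= muleA -EFinM mulVf ?gt_eqF// mul1e.
by rewrite ge0_integral_pushforward//; exact: measurable_scale.
Qed.
End scaling.

Section tuples.
Context {R : realType}.
Local Open Scope ereal_scope.
Local Notation T k := (k.-tuple (measurableTypeR R)).
Local Notation mu := (@lebesgue_measure R).

Lemma ge0_integral_tuple_cons k (g : T k.+1 -> \bar R) :
  measurable_fun setT g -> (forall t, 0 <= g t) ->
  \int[lebesgue_tuple R k.+1]_t g t =
  \int[mu]_z \int[lebesgue_tuple R k]_t g (tuple_cons (z, t)).
Proof.
move=> mg g0.
rewrite ge0_integral_pushforward//=; last exact: measurable_tuple_cons.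
rewrite preimage_setT fubini_tonelli1//.
by apply: measurableT_comp => //; exact: measurable_tuple_cons.
Qed.

Lemma measurable_invr (D : set R) : measurable_fun D (@GRing.inv R).
Proof.
apply: (@measurable_funS _ _ _ _ setT) => //.
(* Inversion is reduced to a real power of a nonnegative number, which is measurable; the formula
   also gives the conventional value 0 at 0. *)
rewrite (_ : @GRing.inv R = fun x => x * (x ^+ 2) `^ (-1))%R.
  apply: measurable_funM => //.
  by apply: (measurableT_comp (measurable_powR (-1))); exact: measurable_funX.
apply/funext => x; have [->|x0] := eqVneq x 0%R; first by rewrite invr0 mul0r.
by rewrite powR_inv1 ?sqr_ge0//; field.
Qed.

Definition scale_tuple k (c : R) (t : T k) : T k := [tuple of map ( *%R c) t].

Definition sqnorm k (t : T k) : R := (\sum_i tnth t i ^+ 2)%R.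

Definition norm_tuple k (t : T k) : R := Num.sqrt (sqnorm t).

Lemma tnth_scale_tuple k c (t : T k) i :
  tnth (scale_tuple c t) i = (c * tnth t i)%R.
Proof. by rewrite tnth_map. Qed.

Lemma scale_tuple_cons k c z (t : T k) :
  scale_tuple c (tuple_cons (z, t)) = tuple_cons ((c * z)%R, scale_tuple c t).
Proof. exact/val_inj. Qed.

Lemma scale_tupleA k a b (t : T k) :
  scale_tuple a (scale_tuple b t) = scale_tuple (a * b)%R t.
Proof. by apply: eq_from_tnth => i; rewrite !tnth_scale_tuple mulrA. Qed.

Lemma sqnorm_scale_tuple k c (t : T k) :
  sqnorm (scale_tuple c t) = (c ^+ 2 * sqnorm t)%R.
Proof.
rewrite /sqnorm mulr_sumr; apply: eq_bigr => i _.
by rewrite tnth_scale_tuple exprMn.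
Qed.

Lemma sqnorm_ge0 k (t : T k) : (0 <= sqnorm t)%R.
Proof. by apply: sumr_ge0 => i _; exact: sqr_ge0. Qed.

Lemma norm_tuple_ge0 k (t : T k) : (0 <= norm_tuple t)%R.
Proof. exact: sqrtr_ge0. Qed.

Lemma sqr_norm_tuple k (t : T k) : (norm_tuple t ^+ 2 = sqnorm t)%R.
Proof. by rewrite sqr_sqrtr// sqnorm_ge0. Qed.

Lemma norm_scale_tuple k c (t : T k) : (0 <= c)%R ->
  norm_tuple (scale_tuple c t) = (c * norm_tuple t)%R.
Proof.
by move=> c0; rewrite /norm_tuple sqnorm_scale_tuple sqrtrM ?sqr_ge0//
  sqrtr_sqr ger0_norm.
Qed.

Lemma measurable_sqnorm k : measurable_fun [set: T k] (@sqnorm k).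
Proof.
apply: measurable_sum => i; apply: measurable_funX.
exact: measurable_tnth.
Qed.

Lemma measurable_norm_tuple k : measurable_fun [set: T k] (@norm_tuple k).
Proof.
have -> : @norm_tuple k = (fun t => sqnorm t `^ 2^-1)%R.
  by apply/funext => t; rewrite /norm_tuple powR12_sqrt// sqnorm_ge0.
by apply: (measurableT_comp (measurable_powR 2^-1)); exact: measurable_sqnorm.
Qed.

Lemma measurable_scale_tuple d (X : measurableType d) k (c : X -> R) (f : X ->
  T k) :
  measurable_fun setT c -> measurable_fun setT f ->
  measurable_fun setT (fun x => scale_tuple (c x) (f x)).
Proof.
move=> mc mf; apply/measurable_fun_tnthP => i.
rewrite (_ : _ \o _ = (fun x => c x * tnth (f x) i)%R); last first.
  by apply/funext => x /=; rewrite tnth_scale_tuple.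
apply: measurable_funM => //.
by apply: (@measurableT_comp _ _ _ _ _ _ (fun t : T k => tnth t i)) => //;
  exact: measurable_tnth.
Qed.

(** Induction on the dimension: Tonelli isolates one coordinate, which contributes a factor c^-1 by
    the scaling of the line. *)
Lemma ge0_integral_scale_tuple k (c : R) (g : T k -> \bar R) : (0 < c)%R ->
  measurable_fun setT g -> (forall t, 0 <= g t) ->
  \int[lebesgue_tuple R k]_t g (scale_tuple c t) =
  (c ^- k)%:E * \int[lebesgue_tuple R k]_t g t.
Proof.
move=> c0; elim: k g => [|k IH] g mg g0.
  rewrite expr0 invr1 mul1e; apply: eq_integral => t _.
  by congr g; apply/val_inj; rewrite /= tuple0.
have mgs : measurable_fun [set: T k.+1] (fun t => g (scale_tuple c t)).
  by apply: measurableT_comp => //; exact: measurable_scale_tuple.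
rewrite !ge0_integral_tuple_cons//.
have mg2 : measurable_fun setT (fun z : measurableTypeR R * T k => g
  (tuple_cons z)).
  by apply: measurableT_comp => //; exact: measurable_tuple_cons.
transitivity (\int[mu]_z ((c ^- k)%:E *
    \int[lebesgue_tuple R k]_t g (tuple_cons (c * z, t)%R))).
  apply: eq_integral => z _.
  under eq_integral do rewrite scale_tuple_cons.
  rewrite (IH (fun t => g (tuple_cons ((c * z)%R, t))))//.
  by apply: measurableT_comp mg2 _; exact: measurable_pair1.
have mF : measurable_fun [set: measurableTypeR R] (fun z => \int[lebesgue_tuple
  R k]_t g (tuple_cons (z, t))).
  exact: (@measurable_fun_fubini_tonelli_F _ _ _ _ _ _ _ mg2).
have F0 z : 0 <= \int[lebesgue_tuple R k]_t g (tuple_cons (z, t)).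
  by apply: integral_ge0.
rewrite ge0_integralZl; last 4 first.
- exact: measurableT.
- by apply: measurableT_comp mF _; exact: measurable_scale.
- by move=> z _; exact: F0.
- by rewrite lee_fin invr_ge0 exprn_ge0// ltW.
rewrite (@ge0_integral_scale _ c (fun z => \int[lebesgue_tuple R k]_t g
  (tuple_cons (z, t))))//.
by rewrite muleA -EFinM -invfM exprSr mulrC.
Qed.
End tuples.

(** * The polar formula from three substitutions *)

Section polar.
Context {R : realType}.
Local Open Scope ereal_scope.
Local Notation T k := (k.-tuple (measurableTypeR R)).
Local Notation mu := (@lebesgue_measure R).
Local Notation lam m := (lebesgue_tuple R m).

(** The half-line is encoded as a factor of the integrand, so that integrals run over the whole
    line, where scaling and Tonelli apply directly. *)
Definition pos (r : R) : R := (0 < r)%R%:R.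

Lemma pos_ge0 r : (0 <= pos r)%R. Proof. exact: ler0n. Qed.

Lemma posM c r : (0 < c)%R -> pos (c * r) = pos r.
Proof. by move=> c0; rewrite /pos pmulr_rgt0. Qed.

Lemma measurable_pos : measurable_fun [set: R] pos.
Proof.
rewrite (_ : pos = \1_(`]0%R, +oo[)); first exact: measurable_indic.
by apply/funext => r; rewrite /pos indicE mem_setE in_itv/= andbT.
Qed.

(** The origin is a box of singletons. In dimension 0 it carries the whole Dirac mass, whence the
    hypothesis on m. *)
Lemma negligible_sqnorm0 m : (0 < m)%N ->
  lam m [set t | sqnorm t = 0%R] = 0.
Proof.
move=> m0; rewrite (_ : [set t | _] =
    [set t : T m | forall i, [set 0%R] (tnth t i)]); last first.
  apply/seteqP; split => t /=; rewrite /sqnorm.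
    move=> /eqP; rewrite psumr_eq0; last by move=> i _; exact: sqr_ge0.
    by move=> /allP/= + i => /(_ i (mem_index_enum _));
      rewrite sqrf_eq0 => /eqP.
  by move=> t0; apply: big1 => i _; rewrite t0 expr0n.
rewrite (@lebesgue_tuple_box R m (fun=> [set 0%R])); last by move=> i;
  exact: measurable_set1.
by case: m m0 => // m _; rewrite big_ord_recl lebesgue_measure_set1 mul0e.
Qed.

Lemma ae_sqnorm_gt0 m : (0 < m)%N -> \forall t \ae lam m, (0 < norm_tuple t)%R.
Proof.
move=> m0; exists [set t | sqnorm t = 0%R]; split => [||t /=].
- have := @measurable_sqnorm R m measurableT _ (measurable_set1 0%R).
  by rewrite setTI.
- exact: negligible_sqnorm0.
- apply: contra_notP => /eqP t0.
  by rewrite sqrtr_gt0 lt_neqAle eq_sym t0 sqnorm_ge0.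
Qed.

(** Identities involving the direction of y fail only at the origin; this lets them pass under the
    integral. *)
Lemma ge0_integral_tuple_ae m (f g : T m -> \bar R) : (0 < m)%N ->
  measurable_fun setT f -> measurable_fun setT g ->
  (forall t, 0 <= f t) -> (forall t, 0 <= g t) ->
  (forall t, (0 < norm_tuple t)%R -> f t = g t) ->
  \int[lam m]_t f t = \int[lam m]_t g t.
Proof.
move=> m0 mf mg f0 g0 fg; apply: ge0_ae_eq_integral => //.
have := ae_sqnorm_gt0 m0; apply: filterS => t t0 _; exact: fg.
Qed.

(** The next three identities track the Jacobians a, s^m and a of the substitutions, with a the norm
    of the vector. The exponent m+1 is what makes a disappear in the third. *)
Let weight1E (a r p e : R) m : (0 < m)%N ->
  (a * (p * (a * r) ^+ m.-1 * e) = a ^+ m * (p * r ^+ m.-1) * e)%R.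
Proof. by case: m => // m _ /=; rewrite exprMn exprS; ring. Qed.

Let weight2E (a s p e : R) m : (0 < m)%N -> s != 0%R ->
  (s ^+ m * ((s * a) ^+ m * (p * s ^- m.+1) * e) = a ^+ m * (p * s ^+ m.-1) *
    e)%R.
Proof.
case: m => // m _ s0 /=; rewrite exprMn !exprS; field.
by rewrite s0 expf_neq0.
Qed.

Let weight3E (a v p e : R) m : a != 0%R ->
  (a * (a ^+ m * (p * (a * v) ^- m.+1) * e) = p * v ^- m.+1 * e)%R.
Proof.
move=> a0; rewrite exprMn invfM; move: (v ^- m.+1)%R => w.
by rewrite exprS; field; rewrite a0 expf_neq0.
Qed.

Section polar_kernel.
Variables (m : nat) (g : T m -> \bar R).
Hypotheses (m_gt0 : (0 < m)%N) (mg : measurable_fun setT g) (g_ge0 : forall t,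
  0 <= g t).

(** Successive integrands: [h2] comes from [h1] by r = |y| s, and [h3] from [h2] by z = s y, after
    which g no longer involves the radial variable. *)
Let h1 (z : R * T m) : \bar R :=
  (pos z.1 * z.1 ^+ m.-1 * expR (- sqnorm z.2))%R%:E *
  g (scale_tuple (z.1 / norm_tuple z.2)%R z.2).

Let h2 (z : R * T m) : \bar R :=
  (norm_tuple z.2 ^+ m * (pos z.1 * z.1 ^+ m.-1) * expR (- sqnorm z.2))%R%:E *
  g (scale_tuple z.1 z.2).

Let h3 (z : R * T m) : \bar R :=
  (norm_tuple z.2 ^+ m * (pos z.1 * z.1 ^- m.+1) *
    expR (- (sqnorm z.2 / z.1 ^+ 2)))%R%:E * g z.2.

(** What the last substitution s = |z| v leaves. The change v -> 1/v would show it to be the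
    integral of u^(m-1) exp(-u^2) over the half-line; it is evaluated differently, in
    [polar_const_invE]. *)
Definition polar_const_inv : \bar R :=
  \int[mu]_v (pos v * v ^- m.+1 * expR (- (v ^- 2)))%R%:E.

Let mfst : measurable_fun [set: measurableTypeR R * T m] (fst : _ -> R).
Proof. exact: measurable_fst. Qed.
Let msq : measurable_fun [set: measurableTypeR R * T m] (fun z => sqnorm z.2).
Proof. by apply: (measurableT_comp (@measurable_sqnorm R m));
  exact: measurable_snd. Qed.
Let mnt : measurable_fun [set: measurableTypeR R * T m] (fun z => norm_tuple
  z.2).
Proof. by apply: (measurableT_comp (@measurable_norm_tuple R m));
  exact: measurable_snd. Qed.
Let mpos : measurable_fun [set: measurableTypeR R * T m] (fun z => pos z.1).
Proof. exact: (measurableT_comp measurable_pos). Qed.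

Let mh1 : measurable_fun [set: measurableTypeR R * T m] h1.
Proof.
apply: emeasurable_funM.
  apply/measurable_EFinP; apply: measurable_funM.
    by apply: measurable_funM => //; exact: measurable_funX.
  apply: (measurableT_comp (@measurable_expR R)).
  exact: (measurableT_comp (@oppr_measurable R setT)).
apply: (measurableT_comp mg); apply: measurable_scale_tuple;
  last exact: measurable_snd.
by apply: measurable_funM => //;
  exact: (measurableT_comp (@measurable_invr R setT)).
Qed.

Let mh2 : measurable_fun [set: measurableTypeR R * T m] h2.
Proof.
apply: emeasurable_funM.
  apply/measurable_EFinP; apply: measurable_funM.
    apply: measurable_funM; first exact: measurable_funX.
    by apply: measurable_funM => //; exact: measurable_funX.
  apply: (measurableT_comp (@measurable_expR R)).
  exact: (measurableT_comp (@oppr_measurable R setT)).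
by apply: (measurableT_comp mg); apply: measurable_scale_tuple;
  last exact: measurable_snd.
Qed.

Let mh3 : measurable_fun [set: measurableTypeR R * T m] h3.
Proof.
apply: emeasurable_funM; last by apply: (measurableT_comp mg);
  exact: measurable_snd.
apply/measurable_EFinP; apply: measurable_funM.
  apply: measurable_funM; first exact: measurable_funX.
  apply: measurable_funM => //;
    apply: (measurableT_comp (@measurable_invr R setT)).
  exact: measurable_funX.
apply: (measurableT_comp (@measurable_expR R)).
apply: (measurableT_comp (@oppr_measurable R setT));
  apply: measurable_funM => //.
by apply: (measurableT_comp (@measurable_invr R setT)); exact: measurable_funX.
Qed.

Let pos_mul_ge0 a r n : (0 <= a)%R -> (0 <= a * (pos r * r ^+ n))%R.
Proof.
move=> a0; rewrite mulr_ge0// /pos; case: ltP => r0; last by rewrite mul0r.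
by rewrite mul1r exprn_ge0// ltW.
Qed.

Let pos_div_ge0 a r n : (0 <= a)%R -> (0 <= a * (pos r * r ^- n))%R.
Proof.
move=> a0; rewrite mulr_ge0// /pos; case: ltP => r0; last by rewrite mul0r.
by rewrite mul1r invr_ge0 exprn_ge0// ltW.
Qed.

Let h1_ge0 z : 0 <= h1 z.
Proof.
rewrite mule_ge0// lee_fin mulr_ge0 ?expR_ge0//.
by rewrite -[X in (0 <= X)%R]mul1r pos_mul_ge0.
Qed.

Let h2_ge0 z : 0 <= h2 z.
Proof.
by rewrite mule_ge0// lee_fin mulr_ge0 ?expR_ge0// pos_mul_ge0 ?exprn_ge0
  ?norm_tuple_ge0.
Qed.

Let h3_ge0 z : 0 <= h3 z.
Proof.
by rewrite mule_ge0// lee_fin mulr_ge0 ?expR_ge0// pos_div_ge0 ?exprn_ge0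
  ?norm_tuple_ge0.
Qed.

Let h1_h2 y : (0 < norm_tuple y)%R -> \int[mu]_r h1 (r, y) = \int[mu]_r h2 (r,
  y).
Proof.
move=> y0.
have m1 : measurable_fun [set: measurableTypeR R] (fun r => h1 (r, y)).
  by apply: measurableT_comp mh1 _; exact: measurable_pair2.
have := ge0_integral_scale y0 m1 (fun r => h1_ge0 (r, y)).
move=> /(congr1 (fun u => (norm_tuple y)%:E * u)).
rewrite muleA -EFinM (divff (lt0r_neq0 y0)) mul1e => <-.
rewrite -ge0_integralZl//; last 2 first.
- by apply: measurableT_comp m1 _; exact: measurable_scale.
- by rewrite lee_fin norm_tuple_ge0.
apply: eq_integral => r _; rewrite /h1 /h2 /= posM// muleA -EFinM.
rewrite [(_ * r / _)%R]mulrAC divff ?gt_eqF// mul1r; congr (_%:E * _).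
exact: weight1E.
Qed.

Let h2_h3 s : \int[lam m]_y h2 (s, y) = \int[lam m]_y h3 (s, y).
Proof.
have [s0|s0] := ltP 0%R s; last first.
  have ps : pos s = 0%R by rewrite /pos ltNge s0.
  by rewrite !integral0_eq// => y _;
    rewrite /h2 /h3 /= ps !(mul0r, mulr0) mul0e.
have m3 : measurable_fun [set: T m] (fun y => h3 (s, y)).
  by apply: measurableT_comp mh3 _; exact: measurable_pair1.
have := ge0_integral_scale_tuple s0 m3 (fun y => h3_ge0 (s, y)).
move=> /(congr1 (fun u => (s ^+ m)%:E * u)).
rewrite muleA -EFinM (divff (expf_neq0 _ (lt0r_neq0 s0))) mul1e => <-.
rewrite -ge0_integralZl//; last 2 first.
- by apply: measurableT_comp m3 _; exact: measurable_scale_tuple.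
- by rewrite lee_fin exprn_ge0// ltW.
apply: eq_integral => y _; rewrite /h2 /h3 /= muleA -EFinM; congr (_%:E * _).
rewrite norm_scale_tuple ?(ltW s0)// sqnorm_scale_tuple.
rewrite [(_ * sqnorm y / _)%R]mulrAC divff ?sqrf_eq0 ?gt_eqF// mul1r.
by rewrite weight2E// gt_eqF.
Qed.

Let h3_const y : (0 < norm_tuple y)%R ->
  \int[mu]_s h3 (s, y) = polar_const_inv * g y.
Proof.
move=> y0.
have m3 : measurable_fun [set: measurableTypeR R] (fun r => h3 (r, y)).
  by apply: measurableT_comp mh3 _; exact: measurable_pair2.
have := ge0_integral_scale y0 m3 (fun r => h3_ge0 (r, y)).
move=> /(congr1 (fun u => (norm_tuple y)%:E * u)).
rewrite muleA -EFinM (divff (lt0r_neq0 y0)) mul1e => <-.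
rewrite -ge0_integralZl//; last 2 first.
- by apply: measurableT_comp m3 _; exact: measurable_scale.
- by rewrite lee_fin norm_tuple_ge0.
rewrite -ge0_integralZr//; last 2 first.
- apply/measurable_EFinP; apply: measurable_funM.
    apply: measurable_funM; first exact: measurable_pos.
    by apply: (measurableT_comp (@measurable_invr R setT));
      exact: measurable_funX.
  apply: (measurableT_comp (@measurable_expR R)).
  apply: (measurableT_comp (@oppr_measurable R setT)).
  by apply: (measurableT_comp (@measurable_invr R setT));
    exact: measurable_funX.
- by move=> v _; rewrite lee_fin mulr_ge0 ?expR_ge0// -[X in (0 <= X)%R]mul1r
    pos_div_ge0.
apply: eq_integral => v _; rewrite /h3 /= posM// muleA -EFinM; congr (_%:E * _).
rewrite [((norm_tuple y * v) ^+ 2)%R]exprMn sqr_norm_tuple.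
have sq0 : sqnorm y != 0%R by rewrite -sqr_norm_tuple sqrf_eq0 gt_eqF.
rewrite (_ : (sqnorm y / (sqnorm y * v ^+ 2) = v ^- 2)%R);
  last by rewrite invfM mulrA divff// mul1r.
by rewrite weight3E// gt_eqF.
Qed.

(* Substitute r = |y| s, then z = s y, then s = |z| v: after each substitution
   Tonelli's theorem exchanges the integrals. *)
Lemma polar_exp :
  \int[mu]_r \int[lam m]_y ((pos r * r ^+ m.-1 * expR (- sqnorm y))%R%:E *
    g (scale_tuple (r / norm_tuple y)%R y)) = polar_const_inv * \int[lam m]_y g
      y.
Proof.
change (\int[mu]_r \int[lam m]_y h1 (r, y) = polar_const_inv * \int[lam m]_y g
  y).
rewrite (@fubini_tonelli _ _ _ _ _ mu (lam m) h1)//.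
have mF h : measurable_fun [set: measurableTypeR R * T m] h -> (forall z, 0 <=
  h z) ->
    measurable_fun setT (fun y => \int[mu]_r h (r, y)).
  move=> mh h0.
  exact: (@measurable_fun_fubini_tonelli_G _ _ _ _ _ _ _ mh).
have F0 h y : (forall z : R * T m, 0 <= h z) -> 0 <= \int[mu]_r h (r, y).
  by move=> h0; exact: integral_ge0.
rewrite (@ge0_integral_tuple_ae m _ (fun y => \int[mu]_r h2 (r, y)) m_gt0
  (mF _ mh1 h1_ge0) (mF _ mh2 h2_ge0) (fun y => F0 _ y h1_ge0)
  (fun y => F0 _ y h2_ge0) h1_h2).
rewrite -(@fubini_tonelli _ _ _ _ _ mu (lam m) h2)//.
under eq_integral do rewrite h2_h3.
rewrite (@fubini_tonelli _ _ _ _ _ mu (lam m) h3)//.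
rewrite -ge0_integralZl//; last first.
  apply: integral_ge0 => v _.
  by rewrite lee_fin mulr_ge0 ?expR_ge0// -[X in (0 <= X)%R]mul1r pos_div_ge0.
have c0 : 0 <= polar_const_inv.
  apply: integral_ge0 => v _.
  by rewrite lee_fin mulr_ge0 ?expR_ge0// -[X in (0 <= X)%R]mul1r pos_div_ge0.
exact: (ge0_integral_tuple_ae m_gt0 (mF _ mh3 h3_ge0) (measurable_funeM _ mg)
  (fun y => F0 _ y h3_ge0) (fun y => mule_ge0 c0 (g_ge0 y)) h3_const).
Qed.

End polar_kernel.
End polar.

(** * Gaussian moments *)

Section half_gauss.
Context {R : realType}.
Local Notation mu := (@lebesgue_measure R).

(** [gauss_fun] is exp(-x^2), hence variance 1/2 once normalised. The moment lives in [\bar R]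
    because its finiteness is itself derived from the recurrence. *)
Definition half_gauss_moment (a : nat) : \bar R :=
  (\int[mu]_(x in `[0%R, +oo[) (x ^+ a * gauss_fun x)%:E)%E.
Local Notation H := half_gauss_moment.

Let pg (p : {poly R}) (x : R) := p.[x] * gauss_fun x.

Lemma is_derive_poly_gauss p (x : R) :
  is_derive x 1 (pg p) (pg (p^`() - 2 *: ('X * p)) x).
Proof.
rewrite /pg /gauss_fun.
apply: trigger_derive.
rewrite hornerD hornerN hornerZ hornerM hornerX /GRing.scale/=; ring.
Qed.

Lemma continuous_poly_gauss p : continuous (pg p).
Proof.
move=> x; apply: differentiable_continuous; apply/derivable1_diffP.
by have [] := is_derive_poly_gauss p x.
Qed.

(** Polynomials times exp(-x^2) are stable under differentiation, so one primitive serves every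
    integration by parts: ['X^(a.+1)] yields the recurrence, the constant -1/2 the first moment. *)
Lemma poly_gauss_FTC p (b : R) : 0 < b ->
  (\int[mu]_(x in `[0%R, b]) (pg (p^`() - 2 *: ('X * p)) x)%:E =
   (pg p b)%:E - (pg p 0)%:E)%E.
Proof.
move=> b0; have cf q : {within `[0, b], continuous pg q}.
  by apply: continuous_subspaceT => x; exact: continuous_poly_gauss.
apply: continuous_FTC2 => //.
- split => [x _||].
  + by have [] := is_derive_poly_gauss p x.
  + by apply: cvg_at_right_filter; exact: continuous_poly_gauss.
  + by apply: cvg_at_left_filter; exact: continuous_poly_gauss.
- move=> x _; rewrite derive1E.
  exact: (@derive_val _ _ _ _ _ _ _ (is_derive_poly_gauss p x)).
Qed.

(** The endpoints form a general sequence because the substitution t = x^2 in the Gamma integral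
    truncates at (n+1)^2; the lower bound on u makes the intervals exhaust the half-line. *)
Lemma cvg_half_line_seq (f : R -> R) (u : nat -> R) : continuous f ->
  (forall x, 0 <= x -> 0 <= f x) -> nondecreasing_seq u -> (forall n, n.+1%:R
    <= u n) ->
  ((\int[mu]_(x in `[0%R, u n]) (f x)%:E) @[n --> \oo] -->
    \int[mu]_(x in `[0%R, +oo[) (f x)%:E)%E.
Proof.
move=> cf f0 ndu nu.
have -> : `[0%R, +oo[%classic = \bigcup_n `[0%R, u n]%classic :> set R.
  apply/seteqP; split => x /=; rewrite in_itv/= ?andbT.
    move=> x0; exists (Num.truncn x) => //=; rewrite in_itv/= x0/=.
    by rewrite (le_trans _ (nu _))// ltW// truncnS_gt.
  by move=> [n _] /=; rewrite in_itv/= => /andP[].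
apply: ge0_nondecreasing_set_cvg_integral.
- move=> n k nk; apply/subsetPset => x /=; rewrite !in_itv/=.
  by move=> /andP[-> /= xn]; rewrite (le_trans xn)// ndu.
- by move=> n; exact: measurable_itv.
- move=> n; apply/measurable_EFinP; apply: measurable_funTS.
  exact: continuous_measurable_fun.
- by move=> n x /=; rewrite in_itv/= => /andP[x0 _]; rewrite lee_fin f0.
Qed.

Lemma cvg_half_line (f : R -> R) : continuous f -> (forall x, 0 <= x -> 0 <= f
  x) ->
  ((\int[mu]_(x in `[0%R, n.+1%:R]) (f x)%:E) @[n --> \oo] -->
    \int[mu]_(x in `[0%R, +oo[) (f x)%:E)%E.
Proof.
move=> cf f0; apply: (@cvg_half_line_seq f (fun n => n.+1%:R)) => //.
by move=> n k nk; rewrite ler_nat.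
Qed.

(** Squeezed under (k+1)!/x: exp(x^2) dominates x^(2k+2)/(k+1)!, and x^k <= x^(2k+1) for x >= 1. *)
Lemma cvg_Xn_gauss k : (n.+1%:R ^+ k * gauss_fun n.+1%:R : R) @[n --> \oo] -->
  (0 : R).
Proof.
apply: (@squeeze_cvgr _ _ _ _ (fun=> 0) (fun n => k.+1`!%:R * n.+1%:R^-1)).
- apply: nearW => n; apply/andP; split.
    by rewrite mulr_ge0// ?gauss_fun_ge0// exprn_ge0.
  set x : R := n.+1%:R; have x0 : 0 < x by rewrite ltr0n.
  have x1 : 1 <= x by rewrite ler1n.
  rewrite /gauss_fun expRN ler_pdivrMr ?expR_gt0//.
  have := expR_ge1Dxn k (sqr_ge0 x).
  have f0 : (0 : R) < k.+1`!%:R by rewrite ltr0n fact_gt0.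
  move=> h; apply: (@le_trans _ _ (k.+1`!%:R / x * ((x ^+ 2) ^+ k.+1 /
    k.+1`!%:R))).
    rewrite (_ : k.+1`!%:R / x * _ = x ^+ k * x ^+ k.+1); last first.
      rewrite -exprM mulnC exprM expr2 !exprS; field.
      by rewrite !gt_eqF.
    by rewrite ler_peMr ?exprn_ge0 ?(ltW x0)// exprn_ege1.
  rewrite ler_wpM2l ?divr_ge0 ?(ltW x0)//.
  by apply: le_trans h; rewrite lerDr.
- exact: cvg_cst.
- rewrite -[X in _ --> X](mulr0 k.+1`!%:R); apply: cvgMr; exact: cvg_harmonic.
Qed.

(** The derivative of x^(a+1) exp(-x^2) is integrated over [0, n+1], then n tends to infinity. As
    finiteness of the moments is not yet known, the boundary term is added to the side of order a+2
    and no limits are subtracted. *)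
Lemma half_gauss_momentS a : (2%:E * H a.+2 = a.+1%:R%:E * H a)%E.
Proof.
have cM k (c : R) : continuous (fun x : R => c * (x ^+ k * gauss_fun x)).
  have -> : (fun x : R => c * (x ^+ k * gauss_fun x)) = pg (c *: 'X^k).
    by apply/funext => x; rewrite /pg hornerZ hornerXn mulrA.
  exact: continuous_poly_gauss.
have M0 k (c x : R) : 0 <= c -> 0 <= x -> 0 <= c * (x ^+ k * gauss_fun x).
  by move=> c0 x0; rewrite mulr_ge0// mulr_ge0 ?gauss_fun_ge0// exprn_ge0.
have HZ k c : 0 <= c -> (c%:E * H k =
    \int[mu]_(x in `[0%R, +oo[) (c * (x ^+ k * gauss_fun x))%:E)%E.
  move=> c0; rewrite -ge0_integralZl//.
  - apply/measurable_EFinP; apply: measurable_funTS.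
    apply: continuous_measurable_fun.
    rewrite (_ : (fun x : R => _) = (fun x : R => 1 * (x ^+ k * gauss_fun x))).
      exact: cM.
    by apply/funext => x; rewrite mul1r.
  - move=> x /=; rewrite in_itv/= andbT => x0.
    by rewrite lee_fin mulr_ge0 ?gauss_fun_ge0// exprn_ge0.
rewrite !HZ//.
have c1 := cvg_half_line (cM a a.+1%:R) (fun x => M0 a _ x (ler0n _ _)).
have c2 := cvg_half_line (cM a.+2 2) (fun x => M0 a.+2 _ x (ler0n _ _)).
have c3 : ((n.+1%:R ^+ a.+1 * gauss_fun n.+1%:R : R)%:E @[n --> \oo] --> 0%E)%E.
  by apply: cvg_EFin; [exact: nearW|exact: cvg_Xn_gauss].
have := cvgeD (fin_num_adde_defl _ (isT : 0%E \is a fin_num)) c2 c3;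
  rewrite adde0 => /(_ _) c4.
rewrite -(cvg_lim (@ereal_hausdorff R) c4) -(cvg_lim (@ereal_hausdorff R) c1).
congr (limn _); apply/funext => n.
have n0 : (0 : R) < n.+1%:R by rewrite ltr0n.
have dE : pg (('X^(a.+1))^`() - 2 *: ('X * 'X^(a.+1))) = (fun x : R =>
    a.+1%:R * (x ^+ a * gauss_fun x) - 2 * (x ^+ a.+2 * gauss_fun x)).
  apply/funext => x; rewrite /pg derivXn hornerD hornerN hornerZ hornerMn
    hornerM.
  by rewrite !hornerXn hornerX !exprS/=; ring.
have := poly_gauss_FTC 'X^(a.+1) n0; rewrite dE.
rewrite /pg !hornerXn expr0n/= mul0r sube0.
move=> <-.
have int k c : mu.-integrable `[0%R, n.+1%:R] (fun x => (c * (x ^+ k *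
  gauss_fun x))%:E).
  apply: continuous_compact_integrable; first exact: segment_compact.
  by apply: continuous_subspaceT => x; exact: cM.
under [X in (_ + X)%E]eq_integral do rewrite EFinB.
rewrite (integralB _ (int a a.+1%:R) (int a.+2 2))//.
apply: etrans (addeC _ _) _; apply: subeK.
by apply: integrable_fin_num => //; exact: int.
Qed.

Lemma half_gauss_moment0 : H 0 = (Num.sqrt pi / 2)%:E.
Proof.
rewrite -integral0y_gauss; apply: eq_integral => x _.
by rewrite expr0 mul1r.
Qed.

Lemma half_gauss_moment1 : H 1 = (2^-1)%:E.
Proof.
have cM : continuous (fun x : R => x ^+ 1 * gauss_fun x).
  rewrite (_ : (fun x : R => _) = pg 'X); first exact: continuous_poly_gauss.
  by apply/funext => x; rewrite /pg hornerX expr1.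
have c1 := cvg_half_line cM.
have {}c1 := c1 (fun x (x0 : 0 <= x) => mulr_ge0 (exprn_ge0 1 x0)
  (gauss_fun_ge0 x)).
have c2 : ((2^-1 - 2^-1 * (n.+1%:R ^+ 0 * gauss_fun n.+1%:R) : R)%:E @[n -->
  \oo] --> (2^-1)%:E)%E.
  apply: cvg_EFin; first exact: nearW.
  rewrite -[X in _ --> X]subr0 -[X in _ --> _ - X](mulr0 2^-1).
  apply: cvgB; first exact: cvg_cst.
  by apply: cvgMr; exact: cvg_Xn_gauss.
rewrite /H -(cvg_lim (@ereal_hausdorff R) c1) -(cvg_lim (@ereal_hausdorff R)
  c2).
congr (limn _); apply/funext => n.
have n0 : (0 : R) < n.+1%:R by rewrite ltr0n.
have := poly_gauss_FTC (- 2^-1)%:P n0.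
rewrite /pg !hornerC {3}/gauss_fun expr0n/= oppr0 expR0 mulr1 -EFinB opprK
  expr0 mul1r.
rewrite mulNr [X in X%:E]addrC => <-.
apply: eq_integral => x _; congr EFin.
rewrite derivC sub0r hornerN hornerZ hornerM hornerX hornerC expr1.
by congr (_ * _); field.
Qed.

Lemma half_gauss_moment_fin_pos a : exists2 h : R, 0 < h & H a = h%:E.
Proof.
(* The recurrence skips one order, so two consecutive moments are carried through the induction. *)
suff : (exists2 h : R, 0 < h & H a = h%:E) /\ (exists2 h : R, 0 < h & H a.+1 =
  h%:E) by case.
elim: a => [|a [[h h0 Ha] IH]].
  split; [exists (Num.sqrt pi / 2)|exists 2^-1] => //.
  - by rewrite divr_gt0// sqrtr_gt0 pi_gt0.
  - exact: half_gauss_moment0.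
  - exact: half_gauss_moment1.
split => //; exists (a.+1%:R / 2 * h); first by rewrite mulr_gt0 ?divr_gt0.
have := half_gauss_momentS a; rewrite Ha.
move=> /(congr1 (fun u => (2^-1)%:E * u)%E).
by rewrite !muleA -!EFinM mulVf// mul1e => ->; congr EFin; ring.
Qed.

Definition gauss_moment (a : nat) : R :=
  \int[mu]_x (x ^+ a * gauss_fun x) / Num.sqrt pi.

Lemma integrable_Xn_gauss a : mu.-integrable setT (fun x : R => (x ^+ a *
  gauss_fun x)%:E).
Proof.
have cX : continuous (fun x : R => x ^+ a * gauss_fun x).
  rewrite (_ : (fun x : R => _) = pg 'X^a); first exact: continuous_poly_gauss.
  by apply/funext => x; rewrite /pg hornerXn.
apply/integrableP; split.
  by apply/measurable_EFinP; exact: continuous_measurable_fun.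
under eq_integral do rewrite abse_EFin.
rewrite ge0_symfun_integralT//.
- have [h _ Hh] := half_gauss_moment_fin_pos a.
  suff -> : (\int[mu]_(x in [set x : R | (0 <= x)%R]) `|x ^+ a * gauss_fun
    x|%:E = H a)%E.
    by rewrite Hh -EFinM ltry.
  rewrite (_ : [set x | 0 <= x] = `[0%R, +oo[%classic); last first.
    by apply/seteqP; split=> x /=; rewrite in_itv/= andbT.
  rewrite /H; apply: eq_integral => x; rewrite inE/= in_itv/= andbT => x0.
  by rewrite ger0_norm// mulr_ge0 ?gauss_fun_ge0// exprn_ge0.
- by move=> x; apply: (@continuous_comp _ _ _ (fun x : R => x ^+ a * gauss_fun
    x) Num.norm); [exact: cX|exact: norm_continuous].
- by move=> x /=; rewrite !normrM !normrX normrN /gauss_fun sqrrN.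
Qed.

Lemma gauss_moment_odd a : odd a -> gauss_moment a = 0.
Proof.
move=> oa; apply/eqP; rewrite mulf_eq0; apply/orP; left.
set I := Rintegral _ _ _; suff : I = - I by move/eqP;
  rewrite -addr_eq0 -mulr2n mulrn_eq0.
have mN : measurable_fun setT (-%R : measurableTypeR R -> measurableTypeR R).
  exact: oppr_measurable.
have iN : mu.-integrable setT (EFin \o (fun x : R => - (x ^+ a * gauss_fun x))).
  exact: (integrableN (integrable_Xn_gauss a)).
have fN : (fun x : R => (x ^+ a * gauss_fun x)%:E) \o -%R =
    EFin \o (fun x : R => - (x ^+ a * gauss_fun x)).
  apply/funext => x /=; congr EFin.
  by rewrite /gauss_fun sqrrN exprNn -signr_odd oa mulN1r mulNr.
rewrite -mulN1r -RintegralZl//; last exact: integrable_Xn_gauss.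
rewrite /I /Rintegral.
pose pf : {measure set (measurableTypeR R) -> \bar R} :=
  pushforward mu (-%R : measurableTypeR R -> measurableTypeR R).
rewrite [in LHS](@eq_measure_integral _ _ _ _ (pf mN)); last first.
  by move=> A mA _; apply/esym/lebesgue_measureN.
rewrite integral_pushforward//.
- rewrite preimage_setT fN; congr fine; apply: eq_integral => x _ /=.
  by rewrite mulN1r.
- by apply/measurable_int; exact: (integrable_Xn_gauss a).
- by rewrite fN preimage_setT.
Qed.

Lemma gauss_moment_even a : ~~ odd a ->
  gauss_moment a = 2 * fine (H a) / Num.sqrt pi.
Proof.
move=> ea; rewrite /gauss_moment /Rintegral ge0_symfun_integralT//=.
- have [h _ Hh] := half_gauss_moment_fin_pos a.
  congr (_ / _); rewrite (_ : [set x | 0 <= x] = `[0%R, +oo[%classic);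
    last first.
    by apply/seteqP; split=> x /=; rewrite in_itv/= andbT.
  by rewrite -/(H a) Hh.
- by move=> x; rewrite mulr_ge0 ?gauss_fun_ge0// exprn_even_ge0.
- rewrite (_ : (fun x : R => _) = pg 'X^a); first exact: continuous_poly_gauss.
  by apply/funext => x; rewrite /pg hornerXn.
- by move=> x /=; rewrite /gauss_fun sqrrN exprNn -signr_odd (negbTE ea) mul1r.
Qed.

Lemma gauss_momentS a : gauss_moment a.+2 = a.+1%:R / 2 * gauss_moment a.
Proof.
have [oa|ea] := boolP (odd a).
  by rewrite !gauss_moment_odd ?mulr0//= negbK.
rewrite !gauss_moment_even//= ?negbK//.
have [h _ Hh] := half_gauss_moment_fin_pos a.
have [h' _ Hh'] := half_gauss_moment_fin_pos a.+2.
have := half_gauss_momentS a; rewrite Hh Hh' -!EFinM => -[e] /=.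
have -> : h' = a.+1%:R * h / 2 by rewrite -e; field.
by rewrite !mulrA; congr (_ / _); ring.
Qed.

Lemma gauss_moment0 : gauss_moment 0 = 1.
Proof.
rewrite /gauss_moment /Rintegral.
under eq_integral do rewrite expr0 mul1r.
by rewrite integralT_gauss/= divff// gt_eqF// sqrtr_gt0 pi_gt0.
Qed.

Lemma gauss_moment1 : gauss_moment 1 = 0.
Proof. exact: gauss_moment_odd. Qed.
End half_gauss.

Section gauss_tuple.
Context {R : realType}.
Local Open Scope ereal_scope.
Local Notation T k := (k.-tuple (measurableTypeR R)).
Local Notation mu := (@lebesgue_measure R).
Local Notation lam m := (lebesgue_tuple R m).

(** Integrability and value are proved together: the inductive step uses Fubini on a signed
    integrand, which requires integrability of the product over the remaining coordinates. *)
Lemma integral_tuple_prod m (h : 'I_m -> R -> R) :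
  (forall i, mu.-integrable setT (EFin \o h i)) ->
  (lam m).-integrable setT (fun t => (\prod_i h i (tnth t i))%R%:E) /\
  \int[lam m]_t (\prod_i h i (tnth t i))%R%:E = (\prod_i \int[mu]_x h i x)%R%:E.
Proof.
elim: m h => [|k IH] h ih.
  have m0 : measurable_fun [set: T 0] (fun t => (\prod_i h i (tnth t i))%R%:E).
    rewrite (_ : (fun t => _) = cst 1%E); first exact: measurable_cst.
    by apply/funext => t; rewrite big_ord0.
  split.
    apply/integrableP; split => //; rewrite [ltLHS]integral_dirac//=.
      by rewrite big_ord0 diracT normr1 mul1e ltry.
    exact: (measurableT_comp (@abse_measurable R setT) m0).
  by rewrite integral_dirac//= !big_ord0 diracT mul1e.
have [iG eG] := IH (fun i => h (lift ord0 i)) (fun i => ih _).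
set G := (fun t : T k => _) in iG eG.
set F := (fun t : T k.+1 => _).
have mh i : measurable_fun [set: measurableTypeR R] (h i).
  by have /integrableP[/measurable_EFinP] := ih i.
have mF : measurable_fun setT F.
  apply/measurable_EFinP; apply: measurable_prod => i _.
  by apply: (measurableT_comp (mh i)); exact: measurable_tnth.
have FE z : (F \o @tuple_cons (measurableTypeR R) k) z = (h ord0 z.1)%:E * G
  z.2.
  rewrite /F /G /= big_ord_recl tnth0 EFinM; congr (_%:E * _%:E)%E.
  by apply: eq_bigr => i _; rewrite tnthS.
have mFc : measurable_fun setT (F \o @tuple_cons (measurableTypeR R) k).
  by apply: measurableT_comp => //; exact: measurable_tuple_cons.
have G0 : \int[lam k]_t `|G t| < +oo by have /integrableP[] := iG.
have mG : measurable_fun setT G by exact: measurable_int iG.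
have iFc : (mu \x lam k)%E.-integrable setT (F \o @tuple_cons (measurableTypeR
  R) k).
  apply/(@integrable12ltyP _ _ _ _ _ mu (lam k) _ mFc).
  under eq_integral => z _.
    under eq_integral do rewrite FE abseM/=.
    rewrite ge0_integralZl//;
      last exact: (measurableT_comp (@abse_measurable R setT) mG).
    over.
  have mAh : measurable_fun [set: measurableTypeR R] (fun z => `|(h ord0
    z)%:E|).
    by apply: (measurableT_comp (@abse_measurable R setT));
      exact/measurable_EFinP.
  rewrite (ge0_integralZr mu measurableT mAh (fun _ _ => abse_ge0 _));
    last exact: integral_ge0.
  have /integrableP[_ /= h0] := ih ord0.
  by rewrite lte_mul_pinfty//; [exact: integral_ge0|rewrite ge0_fin_numE//;
    exact: integral_ge0].
split.
  apply: integrable_pushforward => //; exact: measurable_tuple_cons.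
rewrite integral_pushforward//; last exact: measurable_tuple_cons.
rewrite preimage_setT -integral12_prod_meas1// /fubini_F.
under eq_integral => z _.
  under eq_integral do rewrite FE/=.
  rewrite integralZl// eG.
  over.
rewrite integralZr//; last exact: ih.
rewrite big_ord_recl EFinM; congr (_ * _)%E.
by rewrite /Rintegral fineK//; apply: integrable_fin_num => //; exact: ih.
Qed.
End gauss_tuple.

(** * Means over the sphere *)

Section sphere_mean.
Context {R : realType}.
Local Open Scope ereal_scope.
Local Notation T k := (k.-tuple (measurableTypeR R)).
Local Notation mu := (@lebesgue_measure R).
Local Notation lam m := (lebesgue_tuple R m).
Local Notation H := (@half_gauss_moment R).

Definition monomial m (a : 'I_m -> nat) (t : T m) : R := (\prod_i tnth t i ^+ a
  i)%R.

(** The density of Y, with independent coordinates of variance 1/2. The product form serves Fubini,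
    the radial form in [gauss_densityE] serves the polar formula. *)
Definition gauss_density m (t : T m) : R :=
  (\prod_i (gauss_fun (tnth t i) / Num.sqrt pi))%R.

(* [direction 0] is [0]; the origin is negligible. *)
Definition direction m (t : T m) : T m := scale_tuple (norm_tuple t)^-1 t.

Lemma measurable_monomial m (a : 'I_m -> nat) : measurable_fun setT (monomial
  a).
Proof.
by apply: measurable_prod => i _; apply: measurable_funX;
  exact: measurable_tnth.
Qed.

Lemma measurable_gauss_density m : measurable_fun setT (@gauss_density m).
Proof.
apply: measurable_prod => i _; apply: measurable_funM => //.
by apply: (measurableT_comp (@measurable_gauss_fun R)); exact: measurable_tnth.
Qed.

Lemma measurable_direction m : measurable_fun setT (@direction m).
Proof.
apply: measurable_scale_tuple => //.
exact: (measurableT_comp (@measurable_invr R setT) (@measurable_norm_tuple R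
  m)).
Qed.

Lemma gauss_densityE m (t : T m) :
  gauss_density t = (expR (- sqnorm t) / Num.sqrt pi ^+ m)%R.
Proof.
rewrite /gauss_density big_split/= prodr_const card_ord exprVn.
by rewrite /gauss_fun -expR_sum /sqnorm -sumrN.
Qed.

Lemma gauss_density_ge0 m (t : T m) : (0 <= gauss_density t)%R.
Proof. by apply: prodr_ge0 => i _;
  rewrite divr_ge0 ?gauss_fun_ge0 ?sqrtr_ge0. Qed.

Definition monomial_gauss_moment m (a : 'I_m -> nat) : R :=
  (\prod_i gauss_moment (a i))%R.

Let mg_int m (a : 'I_m -> nat) i : mu.-integrable setT
  (EFin \o (fun x : R => x ^+ a i * gauss_fun x / Num.sqrt pi)%R).
Proof.
rewrite (_ : _ \o _ = fun x : measurableTypeR R =>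
    ((Num.sqrt pi)^-1%:E * (x ^+ a i * gauss_fun x)%:E)%E).
  apply: integrableZl => //; exact: integrable_Xn_gauss.
by apply/funext => x /=; rewrite -EFinM mulrC.
Qed.

Lemma monomial_gauss_densityE m (a : 'I_m -> nat) t :
  (monomial a t * gauss_density t =
  \prod_i ((fun x : R => x ^+ a i * gauss_fun x / Num.sqrt pi) (tnth t i)))%R.
Proof. by rewrite -big_split/=; apply: eq_bigr => i _; rewrite mulrA. Qed.

Lemma integrable_monomial_gauss m (a : 'I_m -> nat) :
  (lam m).-integrable setT (fun t => (monomial a t * gauss_density t)%:E).
Proof.
have [+ _] := integral_tuple_prod (mg_int a).
by under eq_fun do rewrite -monomial_gauss_densityE.
Qed.

Lemma integral_monomial_gauss m (a : 'I_m -> nat) :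
  \int[lam m]_t (monomial a t * gauss_density t)%:E = (monomial_gauss_moment
    a)%:E.
Proof.
under eq_integral do rewrite monomial_gauss_densityE.
have [_ ->] := integral_tuple_prod (mg_int a).
congr EFin; apply: eq_bigr => i _.
by rewrite RintegralZr//; exact: integrable_Xn_gauss.
Qed.

Lemma integral_gauss_density m : \int[lam m]_t (gauss_density t)%:E = 1.
Proof.
rewrite -[RHS]/(1%R%:E) (_ : 1%R = monomial_gauss_moment ((fun=> 0%N) : 'I_m ->
  nat)).
  rewrite -integral_monomial_gauss; apply: eq_integral => t _.
  by rewrite /monomial big1 ?mul1r// => i _; rewrite expr0.
by rewrite /monomial_gauss_moment big1// => i _; rewrite gauss_moment0.
Qed.

Lemma integrable_gauss_density m :
  (lam m).-integrable setT (fun t => (gauss_density t)%:E).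
Proof.
apply/integrableP; split; first by apply/measurable_EFinP;
  exact: measurable_gauss_density.
under eq_integral do rewrite gee0_abs ?lee_fin ?gauss_density_ge0//.
by rewrite integral_gauss_density ltry.
Qed.

Lemma integral_pos (q : R -> R) : measurable_fun setT q ->
  \int[mu]_r (pos r * q r)%:E = \int[mu]_(r in `[0%R, +oo[) (q r)%:E.
Proof.
move=> mq; rewrite -integral_itv_obnd_cbnd; last first.
  by apply/measurable_EFinP; exact: measurable_funTS.
rewrite [RHS]integral_mkcond; apply: eq_integral => r _.
by rewrite patchE mem_setE in_itv/= andbT /pos; case: ifP => _;
  rewrite ?mul1r ?mul0r.
Qed.

Lemma norm_direction m (t : T m) : (0 < norm_tuple t)%R -> norm_tuple
  (direction t) = 1%R.
Proof.
move=> t0; rewrite /direction norm_scale_tuple ?invr_ge0 ?norm_tuple_ge0//.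
by rewrite mulVf// gt_eqF.
Qed.

Lemma norm_tuple_eq0 m (t : T m) : norm_tuple t = 0%R -> forall i, tnth t i =
  0%R.
Proof.
move=> t0 i; have : sqnorm t == 0%R by rewrite -sqr_norm_tuple t0 expr0n.
rewrite psumr_eq0; last by move=> j _; exact: sqr_ge0.
by move=> /allP/= /(_ i (mem_index_enum _)); rewrite sqrf_eq0 => /eqP.
Qed.

Lemma scale_norm_direction m (t : T m) : scale_tuple (norm_tuple t) (direction
  t) = t.
Proof.
apply: eq_from_tnth => i; rewrite !tnth_scale_tuple mulrA.
have [t0|t0] := eqVneq (norm_tuple t) 0%R; last by rewrite divff// mul1r.
by rewrite t0 mul0r mul0r norm_tuple_eq0.
Qed.

Lemma direction_scale m r (t : T m) : (0 < r)%R -> direction (scale_tuple r t)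
  = direction t.
Proof.
move=> r0; rewrite /direction norm_scale_tuple ?(ltW r0)// scale_tupleA invfM.
by rewrite [(_^-1 * _^-1)%R]mulrC -mulrA mulVf ?gt_eqF// mulr1.
Qed.

Lemma direction_direction m (t : T m) : (0 < norm_tuple t)%R ->
  direction (direction t) = direction t.
Proof. by move=> t0; rewrite {2}/direction direction_scale// invr_gt0. Qed.

Lemma monomial_scale m (a : 'I_m -> nat) r t :
  monomial a (scale_tuple r t) = (r ^+ (\sum_i a i) * monomial a t)%R.
Proof.
rewrite /monomial expr_sum -big_split/=; apply: eq_bigr => i _.
by rewrite tnth_scale_tuple exprMn.
Qed.

(** Coordinates of a direction lie in [-1,1]. The bound makes spherical means of monomials
    integrable and keeps 1 + monomial nonnegative on directions. *)
Lemma norm_monomial_direction_le1 m (a : 'I_m -> nat) t : (`|monomial a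
  (direction t)| <= 1)%R.
Proof.
rewrite normr_prod; apply: prodr_ile1 => i _.
rewrite normr_ge0/= normrX exprn_ile1// tnth_scale_tuple normrM.
rewrite ger0_norm ?invr_ge0 ?norm_tuple_ge0//.
have [t0|] := eqVneq (norm_tuple t) 0%R; first by rewrite t0 invr0 mul0r.
rewrite neq_lt ltNge norm_tuple_ge0/= => t0; rewrite mulrC ler_pdivrMr// mul1r.
rewrite -sqrtr_sqr ler_sqrt ?sqnorm_ge0//.
by rewrite /sqnorm (bigD1 i)//= lerDl; apply: sumr_ge0 => j _; exact: sqr_ge0.
Qed.

(* The constant is identified by testing the polar formula on the Gaussian. *)
Lemma polar_const_invE m : (0 < m)%N -> @polar_const_inv R m = H m.-1.
Proof.
move=> m0.
have mg : measurable_fun [set: T m] (fun t => (gauss_density t)%:E).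
  by apply/measurable_EFinP; exact: measurable_gauss_density.
have := polar_exp m0 mg (fun t => ltac:(rewrite lee_fin;
  exact: gauss_density_ge0)).
rewrite integral_gauss_density mule1 => <-.
have mq : measurable_fun [set: R] (fun r => r ^+ m.-1 * gauss_fun r)%R.
  by apply: measurable_funM;
    [exact: measurable_funX|exact: measurable_gauss_fun].
rewrite /half_gauss_moment -integral_pos//; apply: eq_integral => r _.
have p0 : (0 <= pos r * (r ^+ m.-1 * gauss_fun r))%R.
  rewrite /pos; case: ltP => [r0|]; last by rewrite mul0r.
  by rewrite mul1r mulr_ge0 ?gauss_fun_ge0// exprn_ge0// ltW.
transitivity (\int[lam m]_y ((pos r * (r ^+ m.-1 * gauss_fun r))%:E *
  (gauss_density y)%:E)).
  have [r0|r0] := ltP 0%R r; last first.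
    by apply: eq_integral => y _; rewrite /pos ltNge r0/= !mul0r !mul0e.
  apply: ge0_integral_tuple_ae => //.
  - apply: emeasurable_funM.
      apply/measurable_EFinP; apply: measurable_funM => //.
      apply: (measurableT_comp (@measurable_expR R)).
      by apply: (measurableT_comp (@oppr_measurable R setT));
        exact: measurable_sqnorm.
    apply/measurable_EFinP;
      apply: (measurableT_comp (@measurable_gauss_density m)).
    apply: measurable_scale_tuple => //; apply: measurable_funM => //.
    exact: (measurableT_comp (@measurable_invr R setT) (@measurable_norm_tuple
      R m)).
  - by apply: emeasurable_funM => //; exact: measurable_cst.
  - move=> y; apply: mule_ge0; rewrite lee_fin ?gauss_density_ge0//.
    by rewrite !mulr_ge0 ?expR_ge0 ?exprn_ge0// ?pos_ge0// ltW.
  - by move=> y; rewrite mule_ge0 ?lee_fin ?gauss_density_ge0.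
  - move=> y y0; rewrite -!EFinM !gauss_densityE sqnorm_scale_tuple.
    rewrite -[in (_ * sqnorm y)%R]sqr_norm_tuple -exprMn divfK ?gt_eqF//.
    by rewrite /gauss_fun; congr EFin; ring.
rewrite ge0_integralZl//; last by move=> t _; rewrite lee_fin gauss_density_ge0.
by rewrite integral_gauss_density mule1.
Qed.

(** This is 1/|S^(m-1)|, as [sphere_areaE] shows: the constant of [polar_exp] divided by the
    Gaussian normalisation pi^(m/2). *)
Definition sphere_const m : R := (fine (H m.-1) / Num.sqrt pi ^+ m)%R.

Lemma sqrt_pi_gt0 : (0 < Num.sqrt pi :> R)%R.
Proof. by rewrite sqrtr_gt0 pi_gt0. Qed.

Lemma half_gauss_momentE a : H a = (fine (H a))%:E.
Proof. by have [h _ e] := @half_gauss_moment_fin_pos R a; rewrite e. Qed.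

Lemma half_gauss_moment_gt0 a : (0 < fine (H a))%R.
Proof. by have [h h0 e] := @half_gauss_moment_fin_pos R a; rewrite e. Qed.

Lemma sphere_const_gt0 m : (0 < sphere_const m)%R.
Proof. by rewrite divr_gt0 ?exprn_gt0 ?sqrt_pi_gt0 ?half_gauss_moment_gt0. Qed.

(** [polar_exp] applied to g / pi^(m/2), which turns exp(-|y|^2) into a probability density. *)
Lemma polar m (g : T m -> \bar R) : (0 < m)%N ->
  measurable_fun setT g -> (forall t, 0 <= g t) ->
  \int[mu]_r \int[lam m]_y ((pos r * r ^+ m.-1 * gauss_density y)%:E *
    g (scale_tuple r (direction y))) =
  (sphere_const m)%:E * \int[lam m]_t g t.
Proof.
move=> m0 mg g0.
have c0 : (0 <= (Num.sqrt pi ^+ m)^-1 :> R)%R by rewrite invr_ge0 exprn_ge0//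
  ltW// sqrt_pi_gt0.
pose g' t := ((Num.sqrt pi ^+ m)^-1)%:E * g t.
have mg' : measurable_fun setT g' by exact: measurable_funeM.
have g'0 t : 0 <= g' t by rewrite mule_ge0.
have eg' : \int[lam m]_t g' t = ((Num.sqrt pi ^+ m)^-1)%:E * \int[lam m]_t g t.
  by rewrite ge0_integralZl.
have := polar_exp m0 mg' g'0; rewrite polar_const_invE// half_gauss_momentE.
rewrite eg' muleA -EFinM => <-.
apply: eq_integral => r _; apply: eq_integral => y _.
rewrite /g' muleA -EFinM gauss_densityE /direction scale_tupleA.
by congr (_%:E * _); ring.
Qed.

(** When the integrand splits into a function of the direction and one of the norm, the iterated
    integral factors. With q Gaussian this expresses the independence of |Y| and Y/|Y|. *)
Lemma polar_separated m (h : T m -> R) (q : R -> R) : (0 < m)%N ->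
  measurable_fun setT h -> measurable_fun setT q ->
  (forall t, 0 <= h t)%R -> (forall r, 0 <= r -> 0 <= q r)%R ->
  (sphere_const m)%:E * \int[lam m]_x (h (direction x) * q (norm_tuple x))%:E =
  \int[lam m]_y (h (direction y) * gauss_density y)%:E *
  \int[mu]_(r in `[0%R, +oo[) (r ^+ m.-1 * q r)%:E.
Proof.
move=> m0 mh mq h0 q0.
have mhd : measurable_fun [set: T m] (fun x => h (direction x)).
  exact: (measurableT_comp mh (@measurable_direction m)).
have mhq : measurable_fun setT (fun x : T m => (h (direction x) * q (norm_tuple
  x))%:E).
  apply/measurable_EFinP; apply: measurable_funM => //.
  exact: (measurableT_comp mq (@measurable_norm_tuple R m)).
have mqr : measurable_fun setT (fun r : R => r ^+ m.-1 * q r)%R.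
  by apply: measurable_funM => //; exact: measurable_funX.
have hq0 x : 0 <= (h (direction x) * q (norm_tuple x))%:E.
  by rewrite lee_fin mulr_ge0// q0// norm_tuple_ge0.
have pq0 r : (0 <= pos r * (r ^+ m.-1 * q r))%R.
  rewrite /pos; case: ltP => [/ltW r0|]; last by rewrite mul0r.
  by rewrite mul1r mulr_ge0 ?exprn_ge0 ?q0.
have mhg : measurable_fun setT (fun y : T m => (h (direction y) * gauss_density
  y)%:E).
  by apply/measurable_EFinP; apply: measurable_funM => //;
    exact: measurable_gauss_density.
have hg0 y : 0 <= (h (direction y) * gauss_density y)%:E.
  by rewrite lee_fin mulr_ge0 ?gauss_density_ge0.
rewrite -polar// -integral_pos// -ge0_integralZl//; last 3 first.
- by apply/measurable_EFinP; apply: measurable_funM => //;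
    exact: measurable_pos.
- by move=> r _; rewrite lee_fin.
- exact: integral_ge0.
apply: eq_integral => r _.
rewrite muleC -ge0_integralZl//; last by rewrite lee_fin.
have [r0|r0] := ltP 0%R r; last first.
  by apply: eq_integral => y _; rewrite /pos ltNge r0/= !mul0r !mul0e.
apply: ge0_integral_tuple_ae => //.
- apply: emeasurable_funM.
    by apply/measurable_EFinP; apply: measurable_funM => //;
      exact: measurable_gauss_density.
  apply: (measurableT_comp mhq); apply: measurable_scale_tuple => //.
  exact: measurable_direction.
- by apply: emeasurable_funM => //; exact: measurable_cst.
- move=> y; rewrite mule_ge0// lee_fin.
  by rewrite !mulr_ge0 ?gauss_density_ge0 ?exprn_ge0 ?pos_ge0// ltW.
- by move=> y; rewrite mule_ge0// lee_fin.
- move=> y y0; rewrite direction_scale// direction_direction//.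
  rewrite norm_scale_tuple ?(ltW r0)// norm_direction// mulr1.
  by rewrite -!EFinM; congr EFin; ring.
Qed.

(** This is E[|Y|^d], by [integral_norm_gauss]: |Y| has density proportional to r^(m-1)
    exp(-r^2). *)
Definition norm_gauss_moment m d : R := (fine (H (m.-1 + d)) / fine (H m.-1))%R.

Lemma norm_gauss_moment_gt0 m d : (0 < norm_gauss_moment m d)%R.
Proof. by rewrite divr_gt0// half_gauss_moment_gt0. Qed.

Lemma norm_gauss_moment0 m : norm_gauss_moment m 0 = 1%R.
Proof. by rewrite /norm_gauss_moment addn0 divff// gt_eqF//
  half_gauss_moment_gt0. Qed.

Lemma norm_gauss_momentSS m d : (0 < m)%N ->
  norm_gauss_moment m d.+2 = ((m + d)%:R / 2 * norm_gauss_moment m d)%R.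
Proof.
move=> m0; rewrite /norm_gauss_moment !addnS.
have e : (2 * fine (H (m.-1 + d).+2) = (m.-1 + d).+1%:R * fine (H (m.-1 +
  d)))%R.
  have := @half_gauss_momentS R (m.-1 + d).
  have [h _ ->] := @half_gauss_moment_fin_pos R (m.-1 + d).
  by have [h' _ ->] := @half_gauss_moment_fin_pos R (m.-1 + d).+2 => -[].
have E : (m.-1 + d).+1 = (m + d)%N by rewrite -addSn prednK.
rewrite E in e; rewrite E.
have -> : (fine (H (m + d).+1) = (m + d)%:R * fine (H (m.-1 + d)) / 2)%R.
  by rewrite -e; field.
by rewrite -!mulrA; congr (_ * _)%R; rewrite mulrCA.
Qed.

Let radial_gaussE m d : (0 < m)%N ->
  \int[mu]_(r in `[0%R, +oo[) (r ^+ m.-1 * (r ^+ d * gauss_fun r / Num.sqrt pi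
    ^+ m))%:E =
  (norm_gauss_moment m d * sphere_const m)%:E.
Proof.
move=> m0; have -> : (norm_gauss_moment m d * sphere_const m =
    (Num.sqrt pi ^+ m)^-1 * fine (H (m.-1 + d)))%R.
  rewrite /norm_gauss_moment /sphere_const mulrA divfK ?gt_eqF
    ?half_gauss_moment_gt0//.
  by rewrite mulrC.
rewrite EFinM -half_gauss_momentE -ge0_integralZl//.
- by apply: eq_integral => r _; rewrite -EFinM exprD; congr EFin; ring.
- apply/measurable_EFinP; apply: measurable_funTS; apply: measurable_funM.
    exact: measurable_funX.
  exact: measurable_gauss_fun.
- move=> r /=; rewrite in_itv/= andbT => r0.
  by rewrite lee_fin mulr_ge0 ?gauss_fun_ge0// exprn_ge0.
Qed.

Let radial_density m d (x : T m) :
  (norm_tuple x ^+ d * gauss_density x =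
   norm_tuple x ^+ d * gauss_fun (norm_tuple x) / Num.sqrt pi ^+ m)%R.
Proof. by rewrite gauss_densityE /gauss_fun sqr_norm_tuple mulrA. Qed.

Let measurable_radial m d :
  measurable_fun setT (fun r : R => r ^+ d * gauss_fun r / Num.sqrt pi ^+ m)%R.
Proof.
apply: measurable_funM => //; apply: measurable_funM;
  first exact: measurable_funX.
exact: measurable_gauss_fun.
Qed.

Let radial_ge0 m d (r : R) : (0 <= r -> 0 <= r ^+ d * gauss_fun r / Num.sqrt pi
  ^+ m)%R.
Proof.
by move=> r0; rewrite divr_ge0 ?mulr_ge0 ?exprn_ge0 ?gauss_fun_ge0 ?sqrtr_ge0.
Qed.

(** Finiteness of x is part of the conclusion: a positive multiple of an infinite value is
    infinite. *)
Lemma mule_EFin_cancel (c y : R) (x : \bar R) : (0 < c)%R ->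
  c%:E * x = (y * c)%:E -> x = y%:E.
Proof.
move=> c0; case: x => [x| |]; last 2 first.
- by rewrite gt0_muley ?lte_fin.
- by rewrite gt0_muleNy ?lte_fin.
by rewrite -EFinM mulrC => -[/(mulIf (lt0r_neq0 c0)) ->].
Qed.

Lemma integral_norm_gauss m d : (0 < m)%N ->
  \int[lam m]_x (norm_tuple x ^+ d * gauss_density x)%:E = (norm_gauss_moment m
    d)%:E.
Proof.
move=> m0.
have := @polar_separated m (cst 1%R) _ m0 (measurable_cst _)
  (@measurable_radial m d)
  (fun=> ler01) (@radial_ge0 m d).
under eq_integral do rewrite /cst mul1r -radial_density.
under [X in _ = X * _]eq_integral do rewrite /cst mul1r.
rewrite integral_gauss_density mul1e radial_gaussE//.
exact/mule_EFin_cancel/sphere_const_gt0.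
Qed.

Lemma integrable_norm_gauss m d : (0 < m)%N ->
  (lam m).-integrable setT (fun x => (norm_tuple x ^+ d * gauss_density x)%:E).
Proof.
move=> m0; apply/integrableP; split.
  apply/measurable_EFinP; apply: measurable_funM;
    last exact: measurable_gauss_density.
  by apply: measurable_funX; exact: measurable_norm_tuple.
under eq_integral => x _.
  rewrite gee0_abs; last by rewrite lee_fin mulr_ge0 ?exprn_ge0 ?norm_tuple_ge0
    ?gauss_density_ge0.
  over.
by rewrite integral_norm_gauss// ltry.
Qed.

Lemma integrable_bounded_gauss m (h : T m -> R) (M : R) :
  measurable_fun setT h -> (forall t, `|h t| <= M)%R ->
  (lam m).-integrable setT (fun t => (h t * gauss_density t)%:E).
Proof.
move=> mh hM; apply: (@le_integrable _ _ _ _ setT measurableT _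
  (fun t => M%:E * (gauss_density t)%:E)).
- by apply/measurable_EFinP; apply: measurable_funM => //;
    exact: measurable_gauss_density.
- move=> t _; rewrite -EFinM !abse_EFin lee_fin !normrM ler_wpM2r//.
  by rewrite (le_trans (hM t))// ler_norm.
- by apply: integrableZl => //; exact: integrable_gauss_density.
Qed.

Definition sphere_mean m (h : T m -> R) : R :=
  (\int[lam m]_y (h (direction y) * gauss_density y))%R.

(* Independence of the norm and the direction of a Gaussian vector. Adding 1 to
   the monomial keeps the integrand nonnegative. *)
Lemma sphere_mean_monomial m (a : 'I_m -> nat) : (0 < m)%N ->
  (sphere_mean (monomial a) * norm_gauss_moment m (\sum_i a i) =
    monomial_gauss_moment a)%R.
Proof.
move=> m0; set d := (\sum_i a i)%N.
pose h (t : T m) : R := (`|1 + monomial a t|)%R.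
have mh : measurable_fun setT h.
  apply: (measurableT_comp (@normr_measurable R setT)).
  by apply: measurable_funD => //; exact: measurable_monomial.
have hd t : h (direction t) = (1 + monomial a (direction t))%R.
  rewrite /h ger0_norm//.
  by have := norm_monomial_direction_le1 a t; rewrite ler_norml => /andP[+ _];
    lra.
have := @polar_separated m h _ m0 mh (@measurable_radial m d)
  (fun=> normr_ge0 _) (@radial_ge0 m d).
rewrite radial_gaussE//.
have iM : (lam m).-integrable setT (fun t => (monomial a (direction t) *
  gauss_density t)%:E).
  apply: (@integrable_bounded_gauss _ (fun t => monomial a (direction t)) 1) =>
    //.
    exact: (measurableT_comp (measurable_monomial a) (@measurable_direction m)).
  exact: norm_monomial_direction_le1.
have -> : \int[lam m]_y (h (direction y) * gauss_density y)%:E =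
    (1 + sphere_mean (monomial a))%:E.
  under eq_integral do rewrite hd mulrDl mul1r EFinD.
  rewrite integralD//; last exact: integrable_gauss_density.
  rewrite integral_gauss_density EFinD; congr (_ + _).
  by rewrite /sphere_mean /Rintegral fineK//; exact: integrable_fin_num.
have -> : \int[lam m]_x (h (direction x) *
    (norm_tuple x ^+ d * gauss_fun (norm_tuple x) / Num.sqrt pi ^+ m))%:E =
    (norm_gauss_moment m d + monomial_gauss_moment a)%:E.
  under eq_integral => x _.
    rewrite -radial_density hd mulrDl mul1r mulrA [(monomial _ _ * _)%R]mulrC.
    rewrite -monomial_scale scale_norm_direction EFinD.
    over.
  rewrite integralD//; [|exact: integrable_norm_gauss|exact:
    integrable_monomial_gauss].
  by rewrite integral_norm_gauss// integral_monomial_gauss.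
rewrite -!EFinM => -[e].
have /eqP c0 : sphere_const m != 0%R by rewrite gt_eqF// sphere_const_gt0.
have := sphere_const_gt0 m; move: e; set c := sphere_const m;
  set J := norm_gauss_moment m d.
move=> e c0'; have {}e : (c * (J + monomial_gauss_moment a) = c * ((1 +
  sphere_mean (monomial a)) * J))%R.
  by rewrite e; ring.
have := mulfI (lt0r_neq0 c0') e; lra.
Qed.
End sphere_mean.

(** * The area of the sphere and the Gamma function *)

Section sphere_area.
Context {R : realType}.
Local Notation mu := (@lebesgue_measure R).

(** The substitution t = x^2. In dimension m+2 the exponent of t is m/2 >= 0, so the integrand
    extends continuously to 0; dimension 1 is treated apart in [sphere_area]. *)
Lemma integral_gamma_half m :
  (\int[mu]_(t in `]0%R, +oo[) (t `^ (m.+2%:R / 2 - 1) * expR (- t))%:E =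
   2%:E * half_gauss_moment m.+1)%E.
Proof.
pose G (t : R) := Num.sqrt t ^+ m * expR (- t).
have cG : continuous G.
  move=> t; apply: cvgM.
    apply: (@continuous_comp _ _ _ (@Num.sqrt R) (fun x => x ^+ m)).
      exact: sqrt_continuous.
    exact: exprn_continuous.
  apply: (@continuous_comp _ _ _ (fun x : R => - x) (@expR R)).
    exact: opp_continuous.
  exact: continuous_expR.
have G0 t : 0 <= G t by rewrite mulr_ge0 ?expR_ge0 ?exprn_ge0 ?sqrtr_ge0.
transitivity (\int[mu]_(t in `[0%R, +oo[) (G t)%:E)%E.
  rewrite -integral_itv_obnd_cbnd; last first.
    apply/measurable_EFinP; apply: measurable_funTS.
    exact: continuous_measurable_fun.
  apply: eq_integral => t; rewrite inE/= in_itv/= andbT => t0.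
  congr (_ * _)%:E.
  rewrite -powR12_sqrt ?(ltW t0)// -powR_mulrn ?powR_ge0// -powRrM.
  congr (_ `^ _); by rewrite -addn2 natrD; field.
pose K (x : R) := 2 * (x ^+ m.+1 * gauss_fun x).
have cK : continuous K.
  move=> x; apply: cvgM; first exact: cvg_cst.
  by apply: cvgM; [exact: exprn_continuous|exact: continuous_gauss_fun].
have K0 x : 0 <= x -> 0 <= K x.
  by move=> x0; rewrite !mulr_ge0 ?gauss_fun_ge0 ?exprn_ge0.
rewrite /half_gauss_moment -ge0_integralZl//; last 2 first.
- apply/measurable_EFinP; apply: measurable_funTS; apply: measurable_funM.
    exact: measurable_funX.
  exact: measurable_gauss_fun.
- move=> x /=; rewrite in_itv/= andbT => x0.
  by rewrite lee_fin mulr_ge0 ?gauss_fun_ge0 ?exprn_ge0.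
rewrite -[RHS]/(\int[mu]_(x in `[0%R, +oo[) (K x)%:E)%E.
(* Substitution is carried out on compact intervals: [0, (n+1)^2] in t corresponds to [0, n+1] in
   x. *)
have c1 := cvg_half_line_seq cG (fun x _ => G0 x).
have {}c1 := c1 (fun n => n.+1%:R ^+ 2).
have nd2 : nondecreasing_seq (fun n => n.+1%:R ^+ 2 : R).
  by move=> n k nk; rewrite lerXn2r ?nnegrE ?ler0n// ler_nat.
have le2 n : n.+1%:R <= n.+1%:R ^+ 2 :> R by rewrite expr2 ler_peMr ?ler0n
  ?ler1n.
have {}c1 := c1 nd2 le2.
have c2 := cvg_half_line cK K0.
rewrite -(cvg_lim (@ereal_hausdorff R) c1) -(cvg_lim (@ereal_hausdorff R) c2).
congr (limn _); apply/funext => n.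
have n0 : (0 : R) < n.+1%:R by rewrite ltr0n.
have d2 (x : R) : is_derive x (1 : R) (fun x : R => x ^+ 2) (2 * x).
  apply: trigger_derive; by rewrite /GRing.scale/=; ring.
have dE : derive1 (fun x : R => x ^+ 2) = (fun x => 2 * x).
  by apply/funext => x; rewrite derive1E; exact: derive_val.
have c2x : continuous (fun x : R => 2 * x).
  by move=> x; apply: cvgM; [exact: cvg_cst|exact: cvg_id].
have := @integration_by_substitution_increasing R (fun x => x ^+ 2) G 0 n.+1%:R
  (ltW n0).
rewrite dE expr0n/= => ->.
- apply: eq_integral => x; rewrite inE/= in_itv/= => /andP[x0 _]; congr EFin.
  by rewrite /G /K /gauss_fun !fctE/= sqrtr_sqr ger0_norm// [_ ^+ m.+1]exprS;
    ring.
- move=> x y; rewrite !in_itv/= => /andP[x0 _] /andP[y0 _] xy.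
  by rewrite ltrXn2r.
- by move=> x _; exact: c2x.
- by apply: cvgP; apply: cvg_at_right_filter; exact: c2x.
- by apply: cvgP; apply: cvg_at_left_filter; exact: c2x.
- split.
  + by move=> x _; have [] := d2 x.
  + by apply: cvg_at_right_filter; exact: exprn_continuous.
  + by apply: cvg_at_left_filter; exact: exprn_continuous.
- by apply: continuous_subspaceT => x; exact: cG.
Qed.

(** In dimension 1 the constant is 1/2, the half-line Gaussian integral being sqrt(pi)/2; otherwise
    Gamma(m/2) is twice the half-line moment of order m-1. *)
Lemma sphere_areaE m : (0 < m)%N -> sphere_area R m = (sphere_const m)^-1.
Proof.
case: m => // -[|m] _; rewrite /sphere_area /sphere_const/=.
  rewrite half_gauss_moment0/= expr1.
  by field; rewrite gt_eqF// sqrt_pi_gt0.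
rewrite /Gamma /Rintegral integral_gamma_half half_gauss_momentE -EFinM/=.
have -> : pi `^ (m.+2%:R / 2) = Num.sqrt pi ^+ m.+2 :> R.
  by rewrite mulrC powRrM powR12_sqrt ?pi_ge0// powR_mulrn ?sqrtr_ge0.
have h0 := half_gauss_moment_gt0 (R := R) m.+1.
by field; rewrite !gt_eqF ?exprn_gt0 ?sqrt_pi_gt0.
Qed.
End sphere_area.

(** * The Laplacian on polynomials *)

Section formal_polynomials.
Context {R : realType} {m : nat}.
Implicit Types (s : seq (R * ('I_m -> nat))) (a : 'I_m -> nat) (x : 'rV[R]_m).

Definition mdegree a := (\sum_i a i)%N.

(* A list of pairs (coefficient, exponent) is a formal polynomial; [fsum phi] is
   the linear form with value [phi a] on the monomial of exponent [a]. *)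
Definition fsum (phi : ('I_m -> nat) -> R) s : R := \sum_(u <- s) u.1 * phi u.2.

Definition mon_row x a : R := \prod_i x 0 i ^+ a i.

Definition feval s x : R := fsum (mon_row x) s.

Lemma fsum_nil phi : fsum phi [::] = 0. Proof. by rewrite /fsum big_nil. Qed.

Lemma fsum_cons phi u s : fsum phi (u :: s) = u.1 * phi u.2 + fsum phi s.
Proof. by rewrite /fsum big_cons. Qed.

Lemma fsum_cat phi s t : fsum phi (s ++ t) = fsum phi s + fsum phi t.
Proof. by rewrite /fsum big_cat. Qed.

Lemma fsum_flatten I (r : seq I) phi (F : I -> seq (R * ('I_m -> nat))) :
  fsum phi (flatten [seq F i | i <- r]) = \sum_(i <- r) fsum phi (F i).
Proof.
elim: r => [|i r IH] /=; first by rewrite fsum_nil big_nil.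
by rewrite fsum_cat IH big_cons.
Qed.

Lemma is_derive_line (f : 'rV[R]_m -> R) x v (g : R -> R) (d : R) :
  (forall h, f (h *: v + x) = g h) -> is_derive (0 : R) (1 : R) g d ->
    is_derive x v f d.
Proof.
move=> fg [dg dd].
have E : (fun h : R => h^-1 *: ((f \o shift x) (h *: v) - f x)) =
    (fun h : R => h^-1 *: ((g \o shift 0) (h *: 1) - g 0)).
  have f0 : f x = g 0 by rewrite -fg scale0r add0r.
  apply/funext => h /=; rewrite f0 fg addr0.
  by congr (_ *: (g _ - _)); rewrite /GRing.scale/= mulr1.
apply: DeriveDef.
  by rewrite /derivable E; exact: dg.
by rewrite /derive E; exact: dd.
Qed.

(** The truncated subtraction leaves a zero exponent unchanged; this is harmless because the
    accompanying coefficient [a j] then vanishes. *)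
Definition lower a j : 'I_m -> nat := fun i => (a i - (i == j))%N.

Lemma is_derive_mon_row a j x :
  is_derive x (delta_mx 0 j) (fun x => mon_row x a) ((a j)%:R * mon_row x
    (lower a j)).
Proof.
pose C := \prod_(i | i != j) x 0 i ^+ a i.
(* Along the line through x in direction j the monomial is a univariate polynomial, differentiated
   at 0. *)
pose P := ('X + (x 0 j)%:P) ^+ a j * C%:P.
apply: (@is_derive_line _ _ _ (horner P)).
  move=> h; rewrite /P hornerM horner_exp hornerD hornerX !hornerC /mon_row
    (bigD1 j)//= !mxE !eqxx mulr1; congr (_ * _).
  by apply: eq_bigr => i ij; rewrite !mxE (negbTE ij) mulr0 add0r.
have -> : (a j)%:R * mon_row x (lower a j) = (a j)%:R * x 0 j ^+ (a j).-1 * C.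
  rewrite /mon_row (bigD1 j)//= /lower eqxx subn1 mulrA; congr (_ * _).
  by apply: eq_bigr => i ij; rewrite (negbTE ij) subn0.
suff <- : P^`().[0] = (a j)%:R * x 0 j ^+ (a j).-1 * C by exact: is_derive_poly.
rewrite /P derivM derivC mulr0 addr0 deriv_exp derivD derivX derivC addr0 mul1r.
by rewrite hornerM hornerMn horner_exp hornerD hornerX !hornerC add0r mulr_natl.
Qed.

Definition fderive j s := [seq (u.1 * (u.2 j)%:R, lower u.2 j) | u <- s].

Lemma is_derive_feval j s x :
  is_derive x (delta_mx 0 j) (feval s) (feval (fderive j s) x).
Proof.
elim: s => [|u s IH].
  rewrite (_ : feval [::] = cst 0); last by apply/funext => y;
    rewrite /feval fsum_nil.
  exact: is_derive_cst.
rewrite (_ : feval (u :: s) = (u.1 *: (fun x => mon_row x u.2) : 'rV[R]_m -> R)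
  + feval s).
  rewrite (_ : feval _ x = u.1 *: ((u.2 j)%:R * mon_row x (lower u.2 j)) +
    feval (fderive j s) x).
    by apply: is_deriveD; apply: is_deriveZ; exact: is_derive_mon_row.
  by rewrite /feval /= fsum_cons /= -mulrA.
by apply/funext => y; rewrite /feval fsum_cons.
Qed.

Lemma derive_feval j s : 'D_(delta_mx 0 j) (feval s) = feval (fderive j s).
Proof. by apply/funext => x; have [_ ->] := is_derive_feval j s x. Qed.

Definition flap s := flatten [seq fderive j (fderive j s) | j <- index_enum
  'I_m].

Lemma laplacian_feval s : laplacian (feval s) = feval (flap s).
Proof.
apply/funext => x; rewrite /laplacian /flap /feval fsum_flatten.
apply: eq_bigr => j _; rewrite derive_feval.
by have [_ ->] := is_derive_feval j (fderive j s) x.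
Qed.

Lemma iter_laplacian_feval N s : iter N (@laplacian R m) (feval s) = feval
  (iter N flap s).
Proof. by elim: N => // N IH; rewrite !iterS IH laplacian_feval. Qed.

(** Transposition: differentiating the list amounts to changing the linear form. The N-th Laplacian
    at 0 can then be computed one exponent at a time, by induction on forms. *)
Lemma fsum_fderive phi j s :
  fsum phi (fderive j s) = fsum (fun a => (a j)%:R * phi (lower a j)) s.
Proof. by rewrite /fsum big_map; apply: eq_bigr => u _ /=; rewrite mulrA. Qed.

Lemma fsum_flap phi s : fsum phi (flap s) =
  fsum (fun a => \sum_j (a j)%:R * ((lower a j j)%:R * phi (lower (lower a j)
    j))) s.
Proof.
rewrite fsum_flatten; under eq_bigr do rewrite !fsum_fderive.
rewrite exchange_big/=; apply: eq_bigr => u _.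
by rewrite mulr_sumr; apply: eq_bigr.
Qed.

(** The value at 0 of Delta^N on the monomial of exponent a. The constant is the one in the
    expansion of E f(Y) = exp(Delta/4) f(0), whose N-th term is Delta^N f(0) / (4^N N!). *)
Definition laplace_coef N a : R :=
  (mdegree a == N.*2)%:R * (4 ^+ N * N`!%:R * monomial_gauss_moment a).

Lemma mdegree_lower a j : (0 < a j)%N -> (mdegree (lower a j)).+1 = mdegree a.
Proof.
move=> aj; rewrite /mdegree (bigD1 j)//= [in RHS](bigD1 j)//= /lower eqxx.
rewrite -addSn subn1 prednK//; congr (_ + _)%N.
by apply: eq_bigr => i ij; rewrite (negbTE ij) subn0.
Qed.

(* Summed over j: under the Gaussian mean, the Laplacian of a homogeneous
   polynomial is multiplication by twice its degree. *)
Lemma gauss_moment_lower2 a j :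
  (a j)%:R * ((a j).-1%:R * monomial_gauss_moment (lower (lower a j) j)) =
  2 * (a j)%:R * monomial_gauss_moment a :> R.
Proof.
rewrite /monomial_gauss_moment (bigD1 j)//= [in RHS](bigD1 j)//= /lower eqxx.
under eq_bigr => i ij do rewrite (negbTE ij) !subn0.
set C := \prod_(i < m | _) _; rewrite -subn1.
case: (a j) => [|[|k]]; first by rewrite !(mulr0, mul0r).
  by rewrite gauss_moment1 !(mulr0, mul0r).
by rewrite !subn1 /= gauss_momentS; field.
Qed.

(** Summing [gauss_moment_lower2] over j produces twice the degree 2N+2, that is 4(N+1): exactly the
    step from 4^N N! to 4^(N+1) (N+1)!. *)
Lemma laplace_coefS N a :
  \sum_j (a j)%:R * ((lower a j j)%:R * laplace_coef N (lower (lower a j) j)) =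
  laplace_coef N.+1 a.
Proof.
transitivity (\sum_j (mdegree a == N.+1.*2)%:R * (4 ^+ N * N`!%:R *
    (2 * (a j)%:R * monomial_gauss_moment a)) : R).
  apply: eq_bigr => j _; rewrite -gauss_moment_lower2.
  have -> : lower a j j = (a j).-1 by rewrite /lower eqxx subn1.
  rewrite /laplace_coef.
  (* For exponents 0 and 1 both sides vanish; only from 2 on does lowering twice reduce the degree
     by exactly 2. *)
  case E : (a j) => [|[|k]]; [by rewrite !(mulr0, mul0r)..|].
  rewrite -(@mdegree_lower a j) ?E// -(@mdegree_lower (lower a j) j);
    last first.
    by rewrite /lower eqxx E.
  by rewrite doubleS !eqSS; ring.
rewrite -mulr_sumr /laplace_coef -mulr_sumr.
have [dE|] := eqVneq (mdegree a) N.+1.*2; last by rewrite !mul0r.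
rewrite !mul1r -mulr_suml -mulr_sumr -natr_sum -/(mdegree a) dE -muln2 factS
  exprS !natrM.
ring.
Qed.

Lemma iter_flap N s : feval (iter N flap s) 0 = fsum (laplace_coef N) s.
Proof.
elim: N s => [|N IH] s.
  apply: eq_bigr => u _; congr (_ * _); rewrite /laplace_coef /mon_row /mdegree.
  rewrite expr0 fact0 !mul1r; case: eqVneq => [|d0].
    move/eqP; rewrite sum_nat_eq0 => /forallP/= a0.
    rewrite mul1r /monomial_gauss_moment.
    by apply: eq_bigr => i _; rewrite (eqP (a0 i)) expr0 gauss_moment0.
  rewrite mul0r; move: d0; rewrite sum_nat_eq0 negb_forall => /existsP[/= i ai].
  by rewrite (bigD1 i)//= mxE expr0n (negbTE ai) mul0r.
by rewrite iterSr IH fsum_flap; apply: eq_bigr => u _; rewrite laplace_coefS.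
Qed.

Lemma iter_laplacian_feval0 N s :
  iter N (@laplacian R m) (feval s) 0 = fsum (laplace_coef N) s.
Proof. by rewrite iter_laplacian_feval iter_flap. Qed.

Definition raise a j : 'I_m -> nat := fun i => (a i + (i == j).*2)%N.

(* The k-th power of the squared Euclidean norm. *)
Fixpoint frad k : seq (R * ('I_m -> nat)) :=
  if k is k'.+1 then
    flatten [seq [seq (u.1, raise u.2 j) | u <- frad k'] | j <- index_enum 'I_m]
  else [:: (1, fun=> 0%N)].

Lemma fsum_fradS phi k :
  fsum phi (frad k.+1) = fsum (fun a => \sum_j phi (raise a j)) (frad k).
Proof.
rewrite fsum_flatten; under eq_bigr do rewrite /fsum big_map/=.
rewrite exchange_big/=; apply: eq_bigr => u _.
by rewrite mulr_sumr.
Qed.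

Lemma feval_frad k x : feval (frad k) x = (\sum_i x 0 i ^+ 2) ^+ k.
Proof.
elim: k => [|k IH].
  rewrite /feval /= fsum_cons fsum_nil addr0 mul1r expr0.
  by rewrite /mon_row big1.
rewrite /feval fsum_fradS exprSr -IH /feval /fsum mulr_suml.
apply: eq_bigr => u _; rewrite -mulrA mulr_sumr; congr (_ * _).
apply: eq_bigr => j _;
  rewrite /mon_row (bigD1 j)//= [in RHS](bigD1 j)//= /raise eqxx.
rewrite exprD [RHS]mulrAC; apply: (congr2 *%R) => //.
by apply: eq_bigr => i ij; rewrite (negbTE ij) addn0.
Qed.

Lemma mdegree_raise a j : mdegree (raise a j) = (mdegree a).+2.
Proof.
rewrite /mdegree (bigD1 j)//= [in RHS](bigD1 j)//= /raise eqxx addnAC addn2.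
by congr (_ + _).+2; apply: eq_bigr => i ij; rewrite (negbTE ij) addn0.
Qed.

Lemma mdegree_frad k : all (fun u => mdegree u.2 == k.*2) (frad k).
Proof.
elim: k => [|k IH] /=; first by rewrite /mdegree big1.
elim: (index_enum _) => //= j r IHr; rewrite all_cat IHr andbT all_map.
by apply: sub_all IH => u /= /eqP ud; rewrite mdegree_raise ud doubleS.
Qed.

Lemma eq_fsum (P : pred ('I_m -> nat)) phi psi s : all (fun u => P u.2) s ->
  (forall a, P a -> phi a = psi a) -> fsum phi s = fsum psi s.
Proof.
move=> + eqP; elim: s => [|u s IH] /=; first by rewrite !fsum_nil.
by move=> /andP[Pu Ps]; rewrite !fsum_cons IH// eqP.
Qed.

Lemma fsumZ phi c s : fsum (fun a => c * phi a) s = c * fsum phi s.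
Proof. by rewrite /fsum mulr_sumr; apply: eq_bigr => u _; rewrite mulrCA. Qed.

Lemma gauss_moment_raise a j : monomial_gauss_moment (raise a j) =
  (a j).+1%:R / 2 * monomial_gauss_moment a :> R.
Proof.
rewrite /monomial_gauss_moment (bigD1 j)//= [in RHS](bigD1 j)//= /raise eqxx
  addn2.
rewrite gauss_momentS [RHS]mulrA; congr (_ * _).
by apply: eq_bigr => i ij; rewrite (negbTE ij) addn0.
Qed.

(** E[|Y|^(2k)] computed from the expansion of |y|^(2k) agrees with the radial computation: raising
    contributes the sum of (a_j + 1)/2 over j, which is (m + 2k)/2 in degree 2k, the factor in
    [norm_gauss_momentSS]. *)
Lemma fsum_gauss_frad k : (0 < m)%N ->
  fsum (@monomial_gauss_moment R m) (frad k) = norm_gauss_moment m k.*2.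
Proof.
move=> m0; elim: k => [|k IH].
  rewrite fsum_cons fsum_nil norm_gauss_moment0 addr0 mul1r.
  by rewrite /monomial_gauss_moment big1// => i _; rewrite gauss_moment0.
rewrite doubleS norm_gauss_momentSS// -IH fsum_fradS -fsumZ.
apply: (@eq_fsum (fun a => mdegree a == k.*2)); first exact: mdegree_frad.
move=> a /eqP ak.
under eq_bigr do rewrite gauss_moment_raise.
rewrite -mulr_suml -mulr_suml -natr_sum; congr (_%:R / 2 * _).
under eq_bigr do rewrite -addn1.
by rewrite big_split/= sum1_card card_ord addnC -ak.
Qed.
End formal_polynomials.

(** * The Bessel operator on even polynomials *)

Section complex_parts.
Context {R : realType}.

Lemma complex_ReD (x y : R[i]) : complex.Re (x + y) = complex.Re x + complex.Re
  y.
Proof. by case: x y => [a b] [c d]. Qed.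

Lemma complex_ImD (x y : R[i]) : complex.Im (x + y) = complex.Im x + complex.Im
  y.
Proof. by case: x y => [a b] [c d]. Qed.

Lemma complex_Re_sum I (r : seq I) (P : pred I) (F : I -> R[i]) :
  complex.Re (\sum_(i <- r | P i) F i) = \sum_(i <- r | P i) complex.Re (F i).
Proof. by rewrite (big_morph _ complex_ReD (erefl : complex.Re 0 = 0)). Qed.

Lemma complex_Im_sum I (r : seq I) (P : pred I) (F : I -> R[i]) :
  complex.Im (\sum_(i <- r | P i) F i) = \sum_(i <- r | P i) complex.Im (F i).
Proof. by rewrite (big_morph _ complex_ImD (erefl : complex.Im 0 = 0)). Qed.

Lemma complex_ReMr (x : R[i]) (r : R) : complex.Re (x * r%:C%C) = complex.Re x
  * r.
Proof. by case: x => a b /=; ring. Qed.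

Lemma complex_ImMr (x : R[i]) (r : R) : complex.Im (x * r%:C%C) = complex.Im x
  * r.
Proof. by case: x => a b /=; ring. Qed.

Lemma complex_eq (x : R[i]) : x = (complex.Re x +i* complex.Im x)%C.
Proof. by case: x. Qed.

Lemma iter_complexify (T : Type) (D : (T -> R) -> (T -> R)) N (f : T -> R[i]) :
  iter N (complexify D) f = (fun x => (iter N D (fun y => complex.Re (f y)) x
    +i*
    iter N D (fun y => complex.Im (f y)) x)%C).
Proof.
elim: N => [|N IH]; first by apply/funext => x /=; rewrite -complex_eq.
by rewrite !iterS IH.
Qed.
End complex_parts.

Section even_polynomials.
Context {R : realType}.
Implicit Types q : {poly R}.

Definition even_eval q (t : R) : R := q.[t ^+ 2].

(** Evenness of the function removes the odd part: f(t) + f(-t) is twice the even part of P at t^2.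
    Real and imaginary parts of the coefficients give two real polynomials in t^2. *)
Lemma even_poly_funsP K (f : R -> R[i]) : @even_poly_funs R (2 * K) f <->
  exists q1 q2, [/\ (size q1 <= K.+1)%N, (size q2 <= K.+1)%N &
    f = fun t => (even_eval q1 t +i* even_eval q2 t)%C].
Proof.
split=> [[[P sP fP] fe]|[q1 [q2 [s1 s2 ->]]]].
  pose E := even_poly P.
  have sE : (size E <= K.+1)%N.
    rewrite (leq_trans (size_even_poly _))// uphalf_half.
    by move: sP; rewrite mul2n; lia.
  have fE t : f t = E.[(t ^+ 2)%:C%C].
    have : f t + f (- t) = E.[(t ^+ 2)%:C%C] *+ 2.
      rewrite fP -{1 2}(poly_even_odd P) !hornerE !horner_comp !hornerE.
      rewrite rmorphN/= sqrrN -rmorphXn/= mulr2n -/E.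
      ring.
    rewrite fe -mulr2n => /eqP; rewrite -subr_eq0 -mulrnBl mulrn_eq0/= subr_eq0.
    by move/eqP.
  exists (\poly_(k < K.+1) complex.Re E`_k), (\poly_(k < K.+1) complex.Im E`_k).
  split; [exact: size_poly..|].
  apply/funext => t; rewrite fE [LHS]complex_eq (horner_coef_wide _ sE).
  rewrite complex_Re_sum complex_Im_sum /even_eval !horner_poly.
  by congr (_ +i* _)%C; apply: eq_bigr => k _;
    rewrite -rmorphXn/= ?complex_ReMr ?complex_ImMr.
pose e q := map_poly (real_complex R) q.
split; last by move=> t; rewrite /even_eval sqrrN.
exists ((e q1 + 'i%C *: e q2) \Po 'X^2).
  rewrite (leq_trans (size_comp_poly_leq _ _))// size_polyXn ltnS.
  have : (size (e q1 + 'i%C *: e q2)%R <= K.+1)%N.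
    rewrite (leq_trans (size_polyD _ _))// geq_max size_map_poly s1/=.
    by rewrite (leq_trans (size_scale_leq _ _))// size_map_poly.
  by move: (size _) => sz; rewrite /=; lia.
apply/funext => t; rewrite horner_comp hornerXn hornerD hornerZ.
rewrite -rmorphXn/= !horner_map/= /even_eval.
by apply/eqP; rewrite eq_complex /=; apply/andP; split; apply/eqP; ring.
Qed.
End even_polynomials.

Section bessel_even.
Context {R : realType} {m : nat}.
Implicit Types q : {poly R}.

(** The Bessel operator for 2 nu + 1 = m - 1, written in the variable u = r^2: it sends q(u) to 2m
    q'(u) + 4u q''(u). *)
Definition bessel_poly q : {poly R} := (2 * m%:R) *: q^`() + 4 *: ('X *
  q^`()^`()).

Lemma bessel_even_eval q :
  bessel (m%:R / 2 - 1) (even_eval q) = even_eval (bessel_poly q).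
Proof.
have eE p : even_eval p = horner (p \Po 'X^2).
  by apply/funext => t; rewrite /even_eval horner_comp hornerXn.
have dE p : derive1 (even_eval p) = (fun r => 2 * r * p^`().[r ^+ 2]).
  rewrite eE; apply/funext => r.
  rewrite (_ : derive1 _ r = (p \Po 'X^2)^`().[r]); last first.
    by rewrite derive1E; exact: derive_val.
  by rewrite deriv_comp derivXn hornerM horner_comp hornerMn !hornerXn expr1;
    ring.
have beE (r : R) : r != 0 -> derive1n 2 (even_eval q) r +
    (2 * (m%:R / 2 - 1) + 1) / r * derive1 (even_eval q) r = even_eval
      (bessel_poly q) r.
  move=> r0; rewrite dE.
  have -> : derive1n 2 (even_eval q) r = 2 * q^`().[r ^+ 2] + 4 * r ^+ 2 *
    q^`()^`().[r ^+ 2].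
    rewrite /derive1n /= dE.
    have -> : (fun r => 2 * r * q^`().[r ^+ 2]) = horner (2 *: ('X * (q^`() \Po
      'X^2))).
      by apply/funext => s;
        rewrite hornerZ hornerM hornerX horner_comp hornerXn mulrA.
    rewrite (_ : derive1 _ r = (2 *: ('X * (q^`() \Po 'X^2)))^`().[r]);
      last first.
      by rewrite derive1E; exact: derive_val.
    rewrite derivZ derivM derivX deriv_comp derivXn.
    rewrite hornerZ hornerD !hornerM !horner_comp hornerMn hornerX hornerC
      !hornerXn.
    ring.
  rewrite /even_eval /bessel_poly hornerD !hornerZ hornerM hornerX.
  move: (q^`().[_]) (q^`()^`().[_]) (m%:R : R) => A B M. field.
  exact: r0.
(* At 0 the operator is a limit over the punctured neighbourhood, where it coincides with a
   continuous polynomial. *)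
apply/funext => r; rewrite /bessel; case: eqP => [->|/eqP]; last exact: beE.
apply/cvg_lim => //.
apply: (@cvg_trans _ (even_eval (bessel_poly q) s @[s --> 0^'])).
  apply: near_eq_cvg; near=> s; rewrite beE//.
  by near: s; exact: nbhs_dnbhs_neq.
apply: cvg_within_filter; rewrite eE; exact: continuous_horner.
Unshelve. all: by end_near. Qed.

Lemma iter_bessel_even N q : iter N (@bessel R (m%:R / 2 - 1)) (even_eval q) =
  even_eval (iter N bessel_poly q).
Proof. by elim: N => // N IH; rewrite !iterS IH bessel_even_eval. Qed.

(** The value of Be^N on r^(2N), normalised like [laplace_coef] with |Y|^(2N) in place of a
    monomial, so that the quotient of the two is a spherical mean. *)
Definition bessel_const N : R := 4 ^+ N * N`!%:R * norm_gauss_moment m N.*2.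

Lemma bessel_constS N : (0 < m)%N -> bessel_const N.+1 =
  bessel_const N * (N.+1%:R * (2 * m%:R + 4 * N%:R)).
Proof.
move=> m0; rewrite /bessel_const doubleS norm_gauss_momentSS// factS exprS.
by rewrite natrM natrD -muln2 natrM; field.
Qed.

Lemma coef_bessel_poly q k :
  (bessel_poly q)`_k = (k.+1%:R * (2 * m%:R + 4 * k%:R)) * q`_k.+1.
Proof.
rewrite /bessel_poly coefD !coefZ coefXM !coef_deriv.
case: k => [|k] /=; first by rewrite mulr1n; ring.
ring.
Qed.

Lemma iter_bessel_poly0 N q : (0 < m)%N ->
  (iter N bessel_poly q).[0] = bessel_const N * q`_N.
Proof.
move=> m0; rewrite horner_coef0; elim: N q => [|N IH] q.
  by rewrite /bessel_const norm_gauss_moment0 fact0 expr0 !mul1r.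
by rewrite iterSr IH coef_bessel_poly bessel_constS// [LHS]mulrA.
Qed.

Lemma iter_bessel_even0 N q : (0 < m)%N ->
  iter N (@bessel R (m%:R / 2 - 1)) (even_eval q) 0 = bessel_const N * q`_N.
Proof. by move=> m0; rewrite iter_bessel_even /even_eval expr0n
  iter_bessel_poly0. Qed.
End bessel_even.

(** * Averages of polynomials *)

Section mpoly_formal.
Context {R : realType} {m : nat}.
Implicit Types (s : seq (R * ('I_m -> nat))) (a : 'I_m -> nat) (x : 'rV[R]_m).

Lemma mpoly_funsD n (f g : 'rV[R]_m -> R[i]) :
  mpoly_funs n f -> mpoly_funs n g -> mpoly_funs n (fun x => f x + g x).
Proof.
move=> [c ->] [d ->]; exists (fun b => c b + d b); apply/funext => x.
by rewrite -big_split/=; apply: eq_bigr => a _; rewrite mulrDl.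
Qed.

Lemma mpoly_funs_monomial n (k : R[i]) a : (mdegree a <= n)%N ->
  mpoly_funs n (fun x : 'rV[R]_m => k * (mon_row x a)%:C%C).
Proof.
move=> an; have ai i : (a i < n.+1)%N.
  by rewrite ltnS (leq_trans _ an)// /mdegree (bigD1 i)//= leq_addr.
pose b : {ffun 'I_m -> 'I_n.+1} := [ffun i => inord (a i)].
have bE i : b i = a i :> nat by rewrite ffunE inordK.
exists (fun c => if c == b then k else 0); apply/funext => x.
rewrite (bigD1 b)/=; last by rewrite (eq_bigr a)//.
rewrite eqxx [X in _ + X]big1 ?addr0; last by move=> c /andP[_ /negbTE ->];
  rewrite mul0r.
rewrite /mon_row rmorph_prod; congr (_ * _); apply: eq_bigr => i _.
by rewrite rmorphXn/= bE.
Qed.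

Lemma mpoly_funs_feval n (k : R[i]) s : all (fun u => mdegree u.2 <= n)%N s ->
  mpoly_funs n (fun x : 'rV[R]_m => k * (feval s x)%:C%C).
Proof.
elim: s => [_|u s IH /andP[un sn]].
  exists (fun=> 0); apply/funext => x; rewrite /feval fsum_nil mulr0.
  by rewrite big1// => a _; rewrite mul0r.
rewrite (_ : (fun x => _) =
    (fun x => (k * u.1%:C%C) * (mon_row x u.2)%:C%C + k * (feval s x)%:C%C)).
  by apply: mpoly_funsD; [exact: mpoly_funs_monomial|exact: IH].
by apply/funext => x; rewrite /feval fsum_cons rmorphD rmorphM/= mulrDr mulrA.
Qed.

(** Splitting the complex coefficients gives two real lists, on which derivatives and means are
    computed separately. *)
Lemma mpoly_funsP n (f : 'rV[R]_m -> R[i]) : mpoly_funs n f <->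
  exists s1 s2, [/\ all (fun u => mdegree u.2 <= n)%N s1,
    all (fun u => mdegree u.2 <= n)%N s2 & f = fun x => (feval s1 x +i* feval
      s2 x)%C].
Proof.
split=> [[c ->]|[s1 [s2 [d1 d2 ->]]]]; last first.
  rewrite (_ : (fun x => _) = (fun x => 1 * (feval s1 x)%:C%C + 'i%C * (feval
    s2 x)%:C%C)).
    by apply: mpoly_funsD; exact: mpoly_funs_feval.
  by apply/funext => x; rewrite mul1r [LHS]complexE.
pose r := [seq b : {ffun 'I_m -> 'I_n.+1} <- index_enum {ffun 'I_m -> 'I_n.+1}
  | (\sum_i b i <= n)%N].
pose s (part : R[i] -> R) := [seq (part (c b), (fun i => b i : nat)) | b :
  {ffun 'I_m -> 'I_n.+1} <- r].
have ds part : all (fun u => mdegree u.2 <= n)%N (s part).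
  by rewrite all_map; apply/allP => a; rewrite mem_filter => /andP[].
exists (s (@complex.Re R)), (s (@complex.Im R)); split => //.
apply/funext => x; rewrite -big_filter -/r [LHS]complex_eq complex_Re_sum
  complex_Im_sum.
have mE (a : {ffun 'I_m -> 'I_n.+1}) : \prod_i (x 0 i)%:C%C ^+ a i = (mon_row x
  (fun i => a i))%:C%C.
  by rewrite rmorph_prod; apply: eq_bigr => i _; rewrite rmorphXn.
congr (_ +i* _)%C; rewrite /feval /fsum big_map; apply: eq_bigr => b _ /=.
  by rewrite mE complex_ReMr.
by rewrite mE complex_ImMr.
Qed.

Lemma monomial_gauss_moment_odd a : odd (mdegree a) ->
  monomial_gauss_moment a = 0 :> R.
Proof.
move=> oa; have [i ai] : exists i, odd (a i).
  apply/existsP; apply: contraLR oa; rewrite negb_exists => /forallP ae.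
  rewrite /mdegree; elim/big_ind: _ => // u v ou ov.
  by rewrite oddD (negbTE ou) (negbTE ov).
by rewrite /monomial_gauss_moment (bigD1 i)//= gauss_moment_odd// mul0r.
Qed.

(** The spherical average, as a polynomial in r^2: coefficient k is the mean of the homogeneous part
    of degree 2k. *)
Definition mean_poly K s : {poly R} :=
  \poly_(k < K.+1) fsum (fun a => (mdegree a == k.*2)%:R * sphere_mean
    (monomial a)) s.

Lemma size_mean_poly K s : (size (mean_poly K s) <= K.+1)%N.
Proof. exact: size_poly. Qed.

(** By independence E[Y^a] is a spherical mean times E[|Y|^(2N)], so the Laplace and Bessel values
    coincide term by term. For N > n/2 both sides are zero. *)
Lemma mean_poly_laplace n s N : (0 < m)%N -> all (fun u => mdegree u.2 <= n)%N
  s ->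
  fsum (laplace_coef N) s = @bessel_const R m N * (mean_poly n./2 s)`_N.
Proof.
move=> m0 sn; rewrite coef_poly; case: ifP => [_|/negbT Nn].
  rewrite -fsumZ; apply: eq_bigr => u _; congr (_ * _).
  rewrite /laplace_coef /bessel_const -(sphere_mean_monomial u.2 m0) -/(mdegree
    _).
  by case: eqVneq => [->|]; rewrite ?mul0r ?mulr0//; ring.
rewrite mulr0 -[RHS](_ : fsum (fun=> 0) s = 0); last first.
  by rewrite /fsum big1// => u _; rewrite mulr0.
apply: (@eq_fsum _ _ (fun a => mdegree a <= n)%N) => // a an.
by rewrite /laplace_coef; case: eqVneq => [E|]; rewrite ?mul0r//; lia.
Qed.

Definition formal_scale (t : R) (y : m.-tuple (measurableTypeR R)) s : R :=
  fsum (fun a => t ^+ mdegree a * monomial a (direction y)) s.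

Lemma feval_scale_direction s t (y : m.-tuple (measurableTypeR R)) :
  feval s (row_of_tuple (scale_tuple t (direction y))) = formal_scale t y s.
Proof.
apply: eq_bigr => u _; congr (_ * _); rewrite -monomial_scale.
by apply: eq_bigr => i _; rewrite mxE.
Qed.

(** Monomials of odd degree have mean zero, so keeping only even degrees in [mean_poly] loses
    nothing. *)
Lemma mean_polyE n s t : (0 < m)%N -> all (fun u => mdegree u.2 <= n)%N s ->
  even_eval (mean_poly n./2 s) t = fsum (fun a => t ^+ mdegree a * sphere_mean
    (monomial a)) s.
Proof.
move=> m0 sn; rewrite /even_eval horner_poly.
under eq_bigr do rewrite /fsum mulr_suml.
rewrite exchange_big/=.
transitivity (fsum (fun a => \sum_(k < n./2.+1)
    (mdegree a == k.*2)%:R * sphere_mean (monomial a) * (t ^+ 2) ^+ k) s).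
  by apply: eq_bigr => u _; rewrite mulr_sumr; apply: eq_bigr => k _;
    rewrite !mulrA.
apply: (@eq_fsum _ _ (fun a => mdegree a <= n)%N) => // a an.
have [oa|ea] := boolP (odd (mdegree a)).
  have -> : sphere_mean (monomial a) = 0 :> R.
    have := sphere_mean_monomial (R := R) a m0;
      rewrite monomial_gauss_moment_odd//.
    by move=> /eqP; rewrite mulf_eq0 (gt_eqF (norm_gauss_moment_gt0 _ _)) orbF
      => /eqP.
  by rewrite mulr0 big1// => k _; rewrite mulr0 mul0r.
have kn : ((mdegree a)./2 < n./2.+1)%N by rewrite ltnS half_leq.
rewrite (bigD1 (Ordinal kn))//= big1 ?addr0; last first.
  move=> k kE; case: eqP => [E|]; last by rewrite !mul0r.
  by case/eqP: kE; apply/val_inj; rewrite /= E doubleK.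
by rewrite even_halfK// eqxx mul1r -exprM mul2n even_halfK// mulrC.
Qed.
End mpoly_formal.

(** * Comparison of the norms *)

Section radial_integrals.
Context {R : realType}.
Local Open Scope ereal_scope.
Local Notation T k := (k.-tuple (measurableTypeR R)).
Local Notation mu := (@lebesgue_measure R).
Local Notation lam m := (lebesgue_tuple R m).

Lemma polar_iterated m (K : R -> R) (g : T m -> R) : (0 < m)%N ->
  measurable_fun setT K -> (forall r, 0 <= K r)%R ->
  measurable_fun setT g -> (forall t, 0 <= g t)%R ->
  (sphere_const m)%:E * \int[lam m]_x (K (norm_tuple x) * g x)%:E =
  \int[mu]_r ((pos r * r ^+ m.-1 * K r)%:E *
    \int[lam m]_y (g (scale_tuple r (direction y)) * gauss_density y)%:E).
Proof.
move=> m0 mK K0 mg g0.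
have mKg : measurable_fun setT (fun x : T m => (K (norm_tuple x) * g x)%:E).
  apply/measurable_EFinP; apply: measurable_funM => //.
  exact: (measurableT_comp mK (@measurable_norm_tuple R m)).
rewrite -polar//; last by move=> t; rewrite lee_fin mulr_ge0.
apply: eq_integral => r _.
have [r0|r0] := ltP 0%R r; last first.
  rewrite integral0_eq => [|y _]; last by rewrite /pos ltNge r0/= !mul0r mul0e.
  by rewrite /pos ltNge r0/= !mul0r mul0e.
have mgr : measurable_fun setT (fun y : T m => g (scale_tuple r (direction y))).
  apply: (measurableT_comp mg); apply: measurable_scale_tuple => //.
  exact: measurable_direction.
have mgg : measurable_fun setT (fun y : T m => (g (scale_tuple r (direction y))
  * gauss_density y)%:E).
  by apply/measurable_EFinP; apply: measurable_funM => //;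
    exact: measurable_gauss_density.
have p0 : (0 <= pos r * r ^+ m.-1 * K r)%R.
  by rewrite !mulr_ge0 ?pos_ge0 ?exprn_ge0// ltW.
rewrite -ge0_integralZl//; last first.
  by move=> y _; rewrite lee_fin mulr_ge0 ?gauss_density_ge0.
apply: ge0_integral_tuple_ae => //.
- apply: emeasurable_funM.
    by apply/measurable_EFinP; apply: measurable_funM => //;
      exact: measurable_gauss_density.
  apply: (measurableT_comp mKg); apply: measurable_scale_tuple => //.
  exact: measurable_direction.
- by apply: emeasurable_funM => //; exact: measurable_cst.
- move=> y; rewrite mule_ge0// lee_fin.
    by rewrite !mulr_ge0 ?gauss_density_ge0 ?exprn_ge0 ?pos_ge0// ltW.
  by rewrite mulr_ge0.
- by move=> y; rewrite mule_ge0// lee_fin mulr_ge0 ?gauss_density_ge0.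
- move=> y y0; rewrite norm_scale_tuple ?(ltW r0)// norm_direction// mulr1.
  by rewrite -!EFinM; congr EFin; ring.
Qed.

Lemma measurable_polar_inner m (g : T m -> R) :
  measurable_fun setT g -> (forall t, 0 <= g t)%R ->
  measurable_fun [set: measurableTypeR R] (fun r =>
    \int[lam m]_y (g (scale_tuple r (direction y)) * gauss_density y)%:E).
Proof.
move=> mg g0.
pose h (z : measurableTypeR R * T m) : \bar R :=
  (g (scale_tuple z.1 (direction z.2)) * gauss_density z.2)%:E.
have mh : measurable_fun setT h.
  apply/measurable_EFinP; apply: measurable_funM.
    apply: (measurableT_comp mg); apply: measurable_scale_tuple.
      exact: measurable_fst.
    by apply: (measurableT_comp (@measurable_direction R m));
      exact: measurable_snd.
  by apply: (measurableT_comp (@measurable_gauss_density R m));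
    exact: measurable_snd.
have h0 z : 0 <= h z by rewrite lee_fin mulr_ge0 ?gauss_density_ge0.
exact: (@measurable_fun_fubini_tonelli_F _ _ _ _ _ (lam m) h mh h0).
Qed.

(** A null set of radii has a null preimage under the norm: [polar_separated] is applied with h = 1
    and q the indicator of that set. *)
Lemma ae_norm_tuple m (P : R -> Prop) : (0 < m)%N ->
  (\forall t \ae mu, P t) -> \forall x \ae lam m, P (norm_tuple x).
Proof.
move=> m0 [N [mN N0 PN]]; exists (@norm_tuple R m @^-1` N); split.
- by have := @measurable_norm_tuple R m measurableT _ mN; rewrite setTI.
- have mI : measurable_fun setT (\1_N : R -> R) by exact: measurable_indic.
  have := @polar_separated R m (cst 1%R) (\1_N) m0 (measurable_cst _) mI
    (fun=> ler01) (fun r _ => ler0n _ _).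
  rewrite (_ : \int[mu]_(r in `[0%R, +oo[) _ = 0) ?mule0; last first.
    rewrite (@ae_eq_integral _ _ _ _ _ (cst 0))//.
    - by rewrite integral_cst// mul0e.
    - apply/measurable_EFinP; apply: measurable_funTS.
      by apply: measurable_funM; [exact: measurable_funX|exact: mI].
    - exists N; split => // r /=; apply: contra_notP => Nr _.
      by rewrite indicE memNset// mulr0.
  rewrite -[X in _ = X](_ : (0 * sphere_const m)%:E = 0); last by rewrite mul0r.
  move=> /(mule_EFin_cancel (sphere_const_gt0 m)).
  under eq_integral do rewrite /cst mul1r.
  have -> : (fun x : T m => (\1_N (norm_tuple x) : R)%:E) =
      (fun x => (\1_(@norm_tuple R m @^-1` N) x)%:E) by [].
  rewrite integral_indic ?setIT//.
  by have := @measurable_norm_tuple R m measurableT _ mN; rewrite setTI.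
- by move=> x /= NPx; apply: PN.
Qed.

Lemma ge0_integral_opp (f : R -> \bar R) :
  measurable_fun [set: measurableTypeR R] f -> (forall x, 0 <= f x) ->
  \int[mu]_x f (- x)%R = \int[mu]_x f x.
Proof.
move=> mf f0.
have mN : measurable_fun setT (-%R : measurableTypeR R -> measurableTypeR R).
  exact: oppr_measurable.
pose pf : {measure set (measurableTypeR R) -> \bar R} :=
  pushforward mu (-%R : measurableTypeR R -> measurableTypeR R).
rewrite [in RHS](@eq_measure_integral _ _ _ _ (pf mN)); last first.
  by move=> A mA _; apply/esym/lebesgue_measureN.
by rewrite ge0_integral_pushforward.
Qed.

Lemma ae_neq0 : \forall r \ae mu, r != 0%R.
Proof.
exists [set 0%R]; split => //; first exact: lebesgue_measure_set1.
by move=> r /= /negP; rewrite negbK => /eqP.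
Qed.

Lemma ae_mono (P Q : R -> Prop) : (forall t, P t -> Q t) ->
  (\forall t \ae mu, P t) -> \forall t \ae mu, Q t.
Proof.
by move=> PQ [N [mN N0 PN]]; exists N; split => // t; apply: contra_notP => Nt;
  apply: PQ; apply: contra_notP Nt => Pt; exact: PN.
Qed.

Lemma ae_opp (P : R -> Prop) : (\forall t \ae mu, P t) -> \forall t \ae mu, P
  (- t)%R.
Proof.
move=> [N [mN N0 PN]]; exists (-%R @^-1` N); split.
- by have := @oppr_measurable R setT measurableT _ mN; rewrite setTI.
- by rewrite -[RHS]N0 -(lebesgue_measureN mN).
- by move=> t /= Pt; apply: PN.
Qed.

Lemma ge0_integral_even (G : R -> R) : measurable_fun setT G ->
  (forall r, 0 <= G r)%R -> (forall r, G (- r) = G r)%R ->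
  \int[mu]_r (G r)%:E = 2%:E * \int[mu]_r (pos r * G r)%:E.
Proof.
move=> mG G0 Ge.
have mp : measurable_fun [set: measurableTypeR R] (fun r => (pos r * G r)%:E).
  by apply/measurable_EFinP; apply: measurable_funM => //;
    exact: measurable_pos.
have p0 r : 0 <= (pos r * G r)%:E by rewrite lee_fin mulr_ge0 ?pos_ge0.
have mpN : measurable_fun [set: measurableTypeR R] (fun r => (pos (- r) * G (-
  r))%:E).
  exact: (measurableT_comp mp (@oppr_measurable R setT)).
rewrite (_ : 2%:E = 1 + 1)// ge0_muleDl// mul1e -[X in _ = _ +
  X]ge0_integral_opp//.
rewrite -ge0_integralD//.
apply: ge0_ae_eq_integral => //.
- exact/measurable_EFinP.
- exact: emeasurable_funD.
- by move=> r _; rewrite lee_fin.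
- by move=> r _; rewrite adde_ge0.
- apply: (ae_mono _ ae_neq0) => r r0 _; rewrite -EFinD Ge -mulrDl /pos oppr_gt0.
  by move: r0; rewrite neq_lt => /orP[] r0;
    rewrite r0 (lt_gtF r0) ?add0r ?addr0 mul1r.
Qed.

(** The graph of a^p lies above its tangent at b. For p > 1 this is Young's inequality for a and
    b^(p-1) with exponents p and p/(p-1); p = 1 has no finite conjugate and is separate. *)
Lemma powR_tangent (p a b : R) : (1 <= p)%R -> (0 <= a)%R -> (0 <= b)%R ->
  (p * b `^ (p - 1) * a <= a `^ p + (p - 1) * b `^ p)%R.
Proof.
rewrite le_eqVlt => /predU1P[<-|p1] a0 b0.
  by rewrite subrr powRr0 mulr1 mul1r mul0r addr0 powRr1.
have p0 : (0 < p)%R by rewrite (lt_trans _ p1).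
have pm0 : (0 < p - 1)%R by rewrite subr_gt0.
pose q : R := (p / (p - 1))%R.
have q0 : (0 < q)%R by rewrite divr_gt0.
have pq : (p^-1 + q^-1 = 1)%R by rewrite /q; field; rewrite !gt_eqF.
have := conjugate_powR a0 (powR_ge0 b (p - 1)) p0 q0 pq.
rewrite -powRrM (_ : (p - 1) * q = p)%R; last by rewrite /q; field;
  rewrite gt_eqF.
rewrite -(ler_pM2l p0) => h.
rewrite -mulrA [(b `^ _ * a)%R]mulrC (le_trans h)// le_eqVlt; apply/orP; left;
  apply/eqP.
by rewrite /q; field; rewrite !gt_eqF.
Qed.

(** The tangent inequality at b is integrated against the probability density. Since its slope is
    nonnegative, b need only be a lower bound of the mean, which is the form that [mean_line_abs]
    supplies. *)
Lemma jensen_gauss m (p b : R) (a : T m -> R) : (1 <= p)%R -> (0 <= b)%R ->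
  measurable_fun setT a -> (forall y, 0 <= a y)%R ->
  b%:E <= \int[lam m]_y (a y * gauss_density y)%:E ->
  (b `^ p)%:E <= \int[lam m]_y (a y `^ p * gauss_density y)%:E.
Proof.
move=> p1 b0 ma a0 bE.
have p0 : (0 < p)%R by rewrite (lt_le_trans _ p1).
have mg := @measurable_gauss_density R m.
have g0 (y : T m) := gauss_density_ge0 y.
have mapow : measurable_fun setT (fun y : T m => a y `^ p)%R.
  exact: (measurableT_comp (measurable_powR p) ma).
have c0 : (0 <= p * b `^ (p - 1))%R by rewrite mulr_ge0 ?powR_ge0// ltW.
have d0 : (0 <= (p - 1) * b `^ p)%R by rewrite mulr_ge0 ?powR_ge0// subr_ge0.
have : (p * b `^ (p - 1))%:E * \int[lam m]_y (a y * gauss_density y)%:E <=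
    \int[lam m]_y (a y `^ p * gauss_density y)%:E + ((p - 1) * b `^ p)%:E.
  rewrite -[X in _ <= _ + X]mule1 -(integral_gauss_density m).
  rewrite -!ge0_integralZl//; last 4 first.
  - exact/measurable_EFinP.
  - by move=> y _; rewrite lee_fin.
  - by apply/measurable_EFinP; exact: measurable_funM.
  - by move=> y _; rewrite lee_fin mulr_ge0.
  rewrite -ge0_integralD//; last 4 first.
  - by move=> y _; rewrite lee_fin mulr_ge0 ?powR_ge0.
  - by apply/measurable_EFinP; exact: measurable_funM.
  - by move=> y _; rewrite -EFinM lee_fin mulr_ge0.
  - by apply: measurable_funeM; exact/measurable_EFinP.
  apply: ge0_le_integral => //.
  - by move=> y _; rewrite -EFinM lee_fin mulr_ge0// mulr_ge0.
  - by apply: measurable_funeM; apply/measurable_EFinP; exact: measurable_funM.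
  - apply: emeasurable_funD; last by apply: measurable_funeM;
      exact/measurable_EFinP.
    by apply/measurable_EFinP; exact: measurable_funM.
  - move=> y _; rewrite -!EFinM -EFinD lee_fin mulrA -mulrDl ler_wpM2r//.
    exact: powR_tangent.
move=> h; have {h} : (p * b `^ (p - 1))%:E * b%:E <=
    \int[lam m]_y (a y `^ p * gauss_density y)%:E + ((p - 1) * b `^ p)%:E.
  by apply: le_trans h; rewrite lee_wpmul2l.
have -> : (p * b `^ (p - 1))%:E * b%:E = (b `^ p)%:E + ((p - 1) * b `^ p)%:E.
  rewrite -EFinM -EFinD; congr EFin.
  have -> : (p * b `^ (p - 1) * b = p * b `^ p)%R.
    rewrite -mulrA; congr (_ * _)%R; have [->|bN0] := eqVneq b 0%R.
      by rewrite mulr0 powR0// gt_eqF.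
    by rewrite -{2}[b]powRr1// -powRD ?subrK// bN0 implybT.
  ring.
(* Only the finite term (p-1) b^p is cancelled; the integral may be infinite. *)
by rewrite leeD2rE.
Qed.
End radial_integrals.

Section averaging.
Context {R : realType} {m : nat}.
Hypothesis m_gt0 : (0 < m)%N.
Implicit Types (s : seq (R * ('I_m -> nat))) (q : {poly R}).
Local Open Scope ereal_scope.
Local Notation T k := (k.-tuple (measurableTypeR R)).
Local Notation mu := (@lebesgue_measure R).
Local Notation lam m := (lebesgue_tuple R m).

Definition tuple_abs s1 s2 (x : T m) : R :=
  Normc.normc (feval s1 (row_of_tuple x) +i* feval s2 (row_of_tuple x))%C.

Definition line_abs q1 q2 (t : R) : R :=
  Normc.normc (even_eval q1 t +i* even_eval q2 t)%C.

Lemma normc_ge0 (z : R[i]) : (0 <= Normc.normc z)%R.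
Proof. by case: z => a b; exact: sqrtr_ge0. Qed.

Lemma measurable_normc d (X : measurableType d) (u v : X -> R) :
  measurable_fun setT u -> measurable_fun setT v ->
  measurable_fun setT (fun x => Normc.normc (u x +i* v x)%C).
Proof.
move=> mmu mv; rewrite /Normc.normc.
rewrite (_ : (fun x => _) = fun x => ((u x ^+ 2 + v x ^+ 2) `^ 2^-1)%R);
  last first.
  by apply/funext => x; rewrite powR12_sqrt// addr_ge0 ?sqr_ge0.
apply: (measurableT_comp (measurable_powR 2^-1)).
by apply: measurable_funD; exact: measurable_funX.
Qed.

Lemma measurable_feval_row s : measurable_fun setT (fun x : T m => feval s
  (row_of_tuple x)).
Proof.
rewrite (_ : (fun x => _) = fun x : T m => (\sum_(u <- s) u.1 * monomial u.2
  x)%R); last first.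
  apply/funext => x; apply: eq_bigr => u _; congr (_ * _)%R.
  by apply: eq_bigr => i _; rewrite mxE.
apply: measurable_sum => u; apply: measurable_funM => //;
  exact: measurable_monomial.
Qed.

Lemma measurable_tuple_abs s1 s2 : measurable_fun setT (tuple_abs s1 s2).
Proof. by apply: measurable_normc; exact: measurable_feval_row. Qed.

Lemma measurable_line_abs q1 q2 : measurable_fun setT (line_abs q1 q2).
Proof.
have mq q : measurable_fun setT (even_eval q).
  apply: (measurableT_comp (f := horner q)).
    by apply: continuous_measurable_fun; exact: continuous_horner.
  exact: exprn_measurable.
by apply: measurable_normc; exact: mq.
Qed.

Lemma line_absN q1 q2 t : line_abs q1 q2 (- t) = line_abs q1 q2 t.
Proof. by rewrite /line_abs /even_eval sqrrN. Qed.

Lemma mean_formal s t :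
  (lam m).-integrable setT (fun y => (formal_scale t y s * gauss_density y)%:E)
    /\
  \int[lam m]_y (formal_scale t y s * gauss_density y)%:E =
  (fsum (fun a => t ^+ mdegree a * sphere_mean (monomial a)) s)%:E.
Proof.
elim: s => [|u s [IHi IHe]].
  have -> : (fun y : T m => (formal_scale t y [::] * gauss_density y)%:E) = cst
    0.
    by apply/funext => y; rewrite /formal_scale fsum_nil mul0r.
  split; first exact: integrable0.
  by rewrite fsum_nil integral0.
have -> : (fun y : T m => (formal_scale t y (u :: s) * gauss_density y)%:E) =
    (fun y => (u.1 * t ^+ mdegree u.2)%:E *
      (monomial u.2 (direction y) * gauss_density y)%:E +
      (formal_scale t y s * gauss_density y)%:E).
  by apply/funext => y; rewrite /formal_scale fsum_cons -EFinM -EFinD;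
    congr EFin; ring.
have iM : (lam m).-integrable setT
    (fun y => (monomial u.2 (direction y) * gauss_density y)%:E).
  apply: (@integrable_bounded_gauss _ _ (fun t => monomial u.2 (direction t))
    1) => //.
    exact: (measurableT_comp (measurable_monomial u.2) (@measurable_direction R
      m)).
  exact: norm_monomial_direction_le1.
have iZ : (lam m).-integrable setT (fun y =>
    (u.1 * t ^+ mdegree u.2)%:E * (monomial u.2 (direction y) * gauss_density
      y)%:E).
  exact: integrableZl.
split; first exact: integrableD.
have sE : \int[lam m]_y (monomial u.2 (direction y) * gauss_density y)%:E =
    (sphere_mean (monomial u.2))%:E.
  by rewrite /sphere_mean /Rintegral fineK//; exact: integrable_fin_num.
by rewrite integralD// IHe integralZl// sE -EFinM -EFinD fsum_cons mulrA.
Qed.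

(* The complex mean A + iB is projected on its own direction; the integrand is
   then bounded by the Cauchy-Schwarz inequality in R^2. *)
Lemma mean_line_abs n s1 s2 t :
  all (fun u => mdegree u.2 <= n)%N s1 -> all (fun u => mdegree u.2 <= n)%N s2
    ->
  (line_abs (mean_poly n./2 s1) (mean_poly n./2 s2) t)%:E <=
  \int[lam m]_y (tuple_abs s1 s2 (scale_tuple t (direction y)) * gauss_density
    y)%:E.
Proof.
move=> d1 d2; set A := even_eval (mean_poly n./2 s1) t.
set B := even_eval (mean_poly n./2 s2) t.
set X := \int[lam m]_y _; set r := line_abs _ _ _.
have X0 : 0 <= X.
  by apply: integral_ge0 => y _;
    rewrite lee_fin mulr_ge0 ?normc_ge0 ?gauss_density_ge0.
have [<-//|rN0] := eqVneq 0%R r.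
have r0 : (0 < r)%R by rewrite lt_neqAle rN0 normc_ge0.
have r2 : (r * r = A * A + B * B)%R.
  rewrite -[RHS]sqr_sqrtr; last by rewrite addr_ge0// -expr2 sqr_ge0.
  by rewrite expr2.
have [i1 e1] := mean_formal s1 t; have [i2 e2] := mean_formal s2 t.
rewrite -(mean_polyE _ m_gt0 d1) -/A in e1;
  rewrite -(mean_polyE _ m_gt0 d2) -/B in e2.
pose h y := (A%:E * (formal_scale t y s1 * gauss_density y)%:E +
  B%:E * (formal_scale t y s2 * gauss_density y)%:E).
have hE : \int[lam m]_y h y = (r * r)%:E.
  rewrite integralD//; [|exact: integrableZl|exact: integrableZl].
  by rewrite !integralZl// e1 e2 r2 EFinD !EFinM.
have ih : (lam m).-integrable setT h.
  by apply: integrableD => //; exact: integrableZl.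
have mh : measurable_fun setT h by exact: measurable_int ih.
have mg : measurable_fun setT (fun y : T m =>
    (tuple_abs s1 s2 (scale_tuple t (direction y)) * gauss_density y)%:E).
  apply/measurable_EFinP; apply: measurable_funM;
    last exact: measurable_gauss_density.
  apply: (measurableT_comp (measurable_tuple_abs s1 s2)).
  by apply: measurable_scale_tuple => //; exact: measurable_direction.
have : (r * r)%:E <= r%:E * X.
  rewrite -hE (le_trans (lee_abs _))// (le_trans (le_abse_integral _ _ mh))//.
  rewrite -ge0_integralZl//; last 2 first.
  - by move=> y _; rewrite lee_fin mulr_ge0 ?normc_ge0 ?gauss_density_ge0.
  - by rewrite lee_fin ltW.
  apply: ge0_le_integral => //.
  - exact: (measurableT_comp (@abse_measurable R setT) mh).
  - exact: measurable_funeM.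
  - move=> y _; rewrite /h -!EFinM -EFinD abse_EFin lee_fin.
    rewrite !mulrA -mulrDl normrM (ger0_norm (gauss_density_ge0 y)) ler_wpM2r
      ?gauss_density_ge0//.
    rewrite /tuple_abs !feval_scale_direction.
    set u := formal_scale t y s1; set v := formal_scale t y s2.
    rewrite /Normc.normc /r /line_abs/= -sqrtrM ?addr_ge0 ?sqr_ge0// -/A -/B.
    rewrite -sqrtr_sqr ler_wsqrtr//.
    rewrite -subr_ge0 (_ : (_ - _ = (A * v - B * u) ^+ 2)%R) ?sqr_ge0//; ring.
by rewrite EFinM lee_pmul2l// lte_fin.
Qed.
End averaging.

Section norm_comparison.
Context {R : realType} {m : nat}.
Hypothesis m_gt0 : (0 < m)%N.
Implicit Types (s : seq (R * ('I_m -> nat))) (q : {poly R}).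
Local Open Scope ereal_scope.
Local Notation T k := (k.-tuple (measurableTypeR R)).
Local Notation mu := (@lebesgue_measure R).
Local Notation lam m := (lebesgue_tuple R m).

(** Symmetric about 0, so that one indicator serves both the segment and, applied to a norm, the
    unit ball. *)
Definition ind1 (r : R) : R := \1_(`[(-1)%R, 1%R]%classic : set R) r.

Lemma ind1_ge0 r : (0 <= ind1 r)%R.
Proof. by rewrite /ind1 indicE ler0n. Qed.

Lemma measurable_ind1 : measurable_fun setT ind1.
Proof. exact: measurable_indic. Qed.

Lemma ind1N r : ind1 (- r) = ind1 r.
Proof.
rewrite /ind1 !indicE; congr (_%:R : R); congr nat_of_bool.
by apply/idP/idP; rewrite !inE/= !in_itv/=; lra.
Qed.

Lemma unit_ball_row (x : T m) :
  \1_(@unit_ball R m) (row_of_tuple x) = ind1 (norm_tuple x) :> R.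
Proof.
rewrite /ind1 !indicE; congr (_%:R : R); congr nat_of_bool.
have E : euclidean_norm (row_of_tuple x) = norm_tuple x.
  by rewrite /euclidean_norm /norm_tuple /sqnorm; congr Num.sqrt;
    apply: eq_bigr => i _; rewrite mxE.
have n0 := norm_tuple_ge0 x.
apply/idP/idP; rewrite !inE/= in_itv/= /unit_ball/= E; first by lra.
by move=> /andP[].
Qed.

Lemma ind1_powR (r a p : R) : p != 0%R -> ((ind1 r * a) `^ p = ind1 r * a `^
  p)%R.
Proof.
move=> p0; rewrite /ind1 indicE; case: (_ \in _); rewrite ?mul1r// !mul0r.
by rewrite powR0.
Qed.

Lemma ball_Lp_norm_fin s1 s2 (p : R) : (1 <= p)%R ->
  ball_Lp_norm p%:E (fun x : 'rV[R]_m => (feval s1 x +i* feval s2 x)%C) =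
  (\int[lam m]_x (ind1 (norm_tuple x) * tuple_abs s1 s2 x `^ p)%:E) `^ p^-1.
Proof.
move=> p1; have p0 : p != 0%R by rewrite gt_eqF// (lt_le_trans _ p1).
rewrite /ball_Lp_norm unlock; congr (_ `^ _); apply: eq_integral => x _ /=.
rewrite unit_ball_row -/(tuple_abs s1 s2 x) ger0_norm ?mulr_ge0 ?ind1_ge0
  ?normc_ge0//.
by rewrite ind1_powR.
Qed.

(** The integrand is even; folding it onto the positive radii gives the 2 of the factor 2/|S|. *)
Lemma weighted_integralE q1 q2 (p : R) :
  \int[mu]_(t in `[(-1)%R, 1%R]) (line_abs q1 q2 t `^ p * `|t| ^+ m.-1)%:E =
  2%:E * \int[mu]_r (pos r * r ^+ m.-1 * (ind1 r * line_abs q1 q2 r `^ p))%:E.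
Proof.
rewrite [LHS]integral_mkcond.
pose G r : R := (ind1 r * (line_abs q1 q2 r `^ p * `|r| ^+ m.-1))%R.
have mG : measurable_fun setT G.
  apply: measurable_funM; first exact: measurable_ind1.
  apply: measurable_funM.
    exact: (measurableT_comp (measurable_powR p) (measurable_line_abs q1 q2)).
  by apply: measurable_funX; exact: normr_measurable.
rewrite [LHS](_ : _ = \int[mu]_x (G x)%:E); last first.
  apply: eq_integral => r _; rewrite patchE /G /ind1 indicE.
  by case: (_ \in _); rewrite ?mul1r ?mul0r.
rewrite (ge0_integral_even mG); last 2 first.
- by move=> r; rewrite !mulr_ge0 ?ind1_ge0 ?powR_ge0 ?exprn_ge0.
- by move=> r; rewrite /G ind1N line_absN normrN.
congr (_ * _); apply: eq_integral => r _; congr EFin; rewrite /G /pos.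
case: ltP => r0; last by rewrite !mul0r.
by rewrite ger0_norm ?(ltW r0)//; ring.
Qed.

Let measurable_abs_powR s1 s2 (p : R) : measurable_fun setT (fun x : T m =>
  tuple_abs s1 s2 x `^ p)%R.
Proof. exact: (measurableT_comp (measurable_powR p) (measurable_tuple_abs s1
  s2)). Qed.

Let measurable_line_powR q1 q2 (p : R) :
  measurable_fun setT (fun r => ind1 r * line_abs q1 q2 r `^ p)%R.
Proof.
apply: measurable_funM; first exact: measurable_ind1.
exact: (measurableT_comp (measurable_powR p) (measurable_line_abs q1 q2)).
Qed.

(** On each sphere, Jensen's inequality follows the bound of the modulus of the mean by the mean of
    the modulus; integrating over the radius recovers the ball. *)
Lemma weighted_le_ball n s1 s2 (p : R) : (1 <= p)%R ->
  all (fun u => mdegree u.2 <= n)%N s1 -> all (fun u => mdegree u.2 <= n)%N s2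
    ->
  \int[mu]_(t in `[(-1)%R, 1%R])
    (line_abs (mean_poly n./2 s1) (mean_poly n./2 s2) t `^ p * `|t| ^+ m.-1)%:E
      <=
  (2 * sphere_const m)%:E *
    \int[lam m]_x (ind1 (norm_tuple x) * tuple_abs s1 s2 x `^ p)%:E.
Proof.
move=> p1 d1 d2; rewrite weighted_integralE EFinM -muleA lee_wpmul2l//.
have a0 (x : T m) : (0 <= tuple_abs s1 s2 x `^ p)%R by exact: powR_ge0.
rewrite (polar_iterated m_gt0 measurable_ind1 ind1_ge0 (measurable_abs_powR s1
  s2 p) a0).
have w0 r : (0 <= pos r * r ^+ m.-1 * ind1 r)%R.
  rewrite mulr_ge0 ?ind1_ge0// /pos; case: ltP => [/ltW r0|_];
    last by rewrite mul0r.
  by rewrite mul1r exprn_ge0.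
have mw : measurable_fun setT (fun r => pos r * r ^+ m.-1 * ind1 r)%R.
  apply: measurable_funM; last exact: measurable_ind1.
  by apply: measurable_funM; [exact: measurable_pos|exact: measurable_funX].
under eq_integral do rewrite mulrA.
apply: ge0_le_integral => //.
- by move=> r _; rewrite lee_fin mulr_ge0 ?powR_ge0.
- apply/measurable_EFinP; apply: measurable_funM => //.
  exact: (measurableT_comp (measurable_powR p) (measurable_line_abs _ _)).
- apply: emeasurable_funM; first exact/measurable_EFinP.
  exact: (measurable_polar_inner (measurable_abs_powR s1 s2 p) a0).
- move=> r _; rewrite EFinM lee_wpmul2l ?lee_fin//.
  apply: (@jensen_gauss _ _ _ _ (fun y => tuple_abs s1 s2 (scale_tuple r
    (direction y)))) => //.
  + exact: normc_ge0.
  + apply: (measurableT_comp (measurable_tuple_abs s1 s2)).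
    by apply: measurable_scale_tuple => //; exact: measurable_direction.
  + by move=> y; exact: normc_ge0.
  + exact: mean_line_abs.
Qed.

(** For a radial integrand the angular factor in [polar_separated] is the total mass 1, so equality
    holds. *)
Lemma radial_ball_eq q1 q2 s1 s2 (p : R) :
  (forall x : T m, tuple_abs s1 s2 x = line_abs q1 q2 (norm_tuple x)) ->
  \int[mu]_(t in `[(-1)%R, 1%R]) (line_abs q1 q2 t `^ p * `|t| ^+ m.-1)%:E =
  (2 * sphere_const m)%:E *
    \int[lam m]_x (ind1 (norm_tuple x) * tuple_abs s1 s2 x `^ p)%:E.
Proof.
move=> rad; rewrite weighted_integralE EFinM -muleA; congr (_ * _).
have h0 r : (0 <= r)%R -> (0 <= ind1 r * line_abs q1 q2 r `^ p)%R.
  by move=> _; rewrite mulr_ge0 ?ind1_ge0 ?powR_ge0.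
have := @polar_separated R m (cst 1%R) _ m_gt0 (measurable_cst _)
  (measurable_line_powR q1 q2 p) (fun=> ler01) h0.
under [X in _ = X * _]eq_integral do rewrite /cst mul1r.
rewrite integral_gauss_density mul1e -integral_pos; last first.
  by apply: measurable_funM => //; exact: measurable_funX.
under eq_integral do rewrite /cst mul1r -rad.
move=> ->; apply: eq_integral => r _; congr EFin.
by rewrite [RHS]mulrA.
Qed.

(** [Lnorm] at [+oo] tests whether the whole space has positive measure. It does, since the Gaussian
    density integrates to 1. *)
Lemma lebesgue_tuple_gt0 : 0 < lam m setT.
Proof.
rewrite lt0e measure_ge0 andbT; apply/eqP => l0.
have := integral_gauss_density (R := R) m.
rewrite null_set_integral//.
- by move=> /esym/eqP; rewrite onee_eq0.
- by apply/measurable_EFinP; exact: measurable_gauss_density.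
Qed.

Lemma ball_Lp_norm_y s1 s2 :
  ball_Lp_norm +oo (fun x : 'rV[R]_m => (feval s1 x +i* feval s2 x)%C) =
  ess_sup (lam m) (fun x => (ind1 (norm_tuple x) * tuple_abs s1 s2 x)%:E).
Proof.
rewrite /ball_Lp_norm unlock lebesgue_tuple_gt0; congr ess_sup;
  apply/funext => x /=.
by rewrite unit_ball_row ger0_norm// mulr_ge0 ?ind1_ge0 ?normc_ge0.
Qed.

Lemma radial_ball_le_y q1 q2 s1 s2 :
  (forall x : T m, tuple_abs s1 s2 x = line_abs q1 q2 (norm_tuple x)) ->
  ess_sup (lam m) (fun x => (ind1 (norm_tuple x) * tuple_abs s1 s2 x)%:E) <=
  ess_sup mu (fun t => (ind1 t * line_abs q1 q2 t)%:E).
Proof.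
move=> rad; apply/ess_supP.
have := ess_sup_ge mu (fun t => (ind1 t * line_abs q1 q2 t)%:E).
move/(ae_norm_tuple m_gt0); apply: filterS => x.
by rewrite rad.
Qed.

Lemma ae_and (P Q : R -> Prop) : (\forall t \ae mu, P t) -> (\forall t \ae mu,
  Q t) ->
  \forall t \ae mu, P t /\ Q t.
Proof.
move=> [N [mN N0 PN]] [M [mM M0 QM]]; exists (N `|` M); split.
- exact: measurableU.
- by rewrite measureU0.
- move=> t /= /not_andP[Pt|Qt]; [left; exact: PN|right; exact: QM].
Qed.

(** A null set meets almost every sphere in a null set of directions: by the polar formula the
    Gaussian integral of its indicator on the sphere of radius r is zero for almost every r > 0, and
    the density is positive. *)
Lemma ae_sphere (P : T m -> Prop) : (\forall x \ae lam m, P x) ->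
  \forall r \ae mu, (0 < r)%R -> \forall y \ae lam m, P (scale_tuple r
    (direction y)).
Proof.
move=> [N [mN N0 PN]].
have mI : measurable_fun setT (\1_N : T m -> R) by exact: measurable_indic.
have i0 (t : T m) : (0 <= (\1_N t : R))%R by rewrite indicE ler0n.
have := polar_iterated m_gt0 (@measurable_cst _ _ _ _ setT (1%R : R)) (fun=>
  ler01) mI i0.
rewrite (_ : \int[lam m]_x _ = 0) ?mule0; last first.
  under eq_integral do rewrite /cst mul1r.
  by rewrite integral_indic// setIT.
pose inner r := \int[lam m]_y ((\1_N (scale_tuple r (direction y)) : R) *
  gauss_density y)%:E.
pose F r : \bar R := (pos r * r ^+ m.-1 * 1)%:E * inner r.
have inner0 r : 0 <= inner r.
  by apply: integral_ge0 => y _; rewrite lee_fin mulr_ge0 ?gauss_density_ge0.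
have minner : measurable_fun [set: measurableTypeR R] inner.
  exact: (measurable_polar_inner mI i0).
have mF : measurable_fun [set: measurableTypeR R] F.
  apply: emeasurable_funM => //; apply/measurable_EFinP;
    apply: measurable_funM => //.
  by apply: measurable_funM; [exact: measurable_pos|exact: measurable_funX].
have F0 r : 0 <= F r.
  rewrite mule_ge0// lee_fin mulr1 /pos; case: ltP => [/ltW r0|_];
    last by rewrite mul0r.
  by rewrite mul1r exprn_ge0.
rewrite -[X in _ = X -> _]/(\int[mu]_r F r) => /esym IF.
have : \int[mu]_r `|F r| = 0.
  by rewrite -[RHS]IF; apply: eq_integral => r _; rewrite gee0_abs.
move/(ae_eq_integral_abs mu measurableT mF); apply: ae_mono => r /(_ I)/= Fr r0.
have Ir : inner r = 0.
  move: Fr; rewrite /F /pos r0 mul1r mulr1 => /eqP.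
  by rewrite mule_eq0 eqe expf_eq0 (gt_eqF r0) andbF/= => /eqP.
have mg : measurable_fun setT (fun y : T m =>
    ((\1_N (scale_tuple r (direction y)) : R) * gauss_density y)%:E).
  apply/measurable_EFinP; apply: measurable_funM;
    last exact: measurable_gauss_density.
  apply: (measurableT_comp mI).
  by apply: measurable_scale_tuple => //; exact: measurable_direction.
have : \int[lam m]_y `|((\1_N (scale_tuple r (direction y)) : R) *
  gauss_density y)%:E| = 0.
  rewrite -[RHS]Ir; apply: eq_integral => y _.
  by rewrite gee0_abs// lee_fin mulr_ge0 ?gauss_density_ge0.
move/(ae_eq_integral_abs (lam m) measurableT mg);
  apply: filterS => y /(_ I)/= [/eqP].
have gp : (0 < gauss_density y)%R.
  by rewrite gauss_densityE divr_gt0 ?expR_gt0 ?exprn_gt0 ?sqrt_pi_gt0.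
rewrite mulf_eq0 (gt_eqF gp) orbF indicE pnatr_eq0 eqb0 => yN.
by apply: contrapT => nP; move/negP: yN; apply; rewrite inE; exact: PN.
Qed.

(** Through [ae_sphere], the essential bound on the ball holds almost everywhere on almost every
    sphere, and a mean inherits it. *)
Lemma weighted_le_ball_y n s1 s2 :
  all (fun u => mdegree u.2 <= n)%N s1 -> all (fun u => mdegree u.2 <= n)%N s2
    ->
  ess_sup mu (fun t => (ind1 t * line_abs (mean_poly n./2 s1) (mean_poly n./2
    s2) t)%:E) <=
  ess_sup (lam m) (fun x => (ind1 (norm_tuple x) * tuple_abs s1 s2 x)%:E).
Proof.
move=> d1 d2.
set y := ess_sup (lam m) _.
have aey : \forall x \ae lam m, (ind1 (norm_tuple x) * tuple_abs s1 s2 x)%:E <=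
  y.
  exact: ess_sup_ge.
have y0 : 0 <= y.
  apply: ess_sup_gee; first exact: lebesgue_tuple_gt0.
  by apply: nearW => x; rewrite lee_fin mulr_ge0 ?ind1_ge0 ?normc_ge0.
case: y y0 aey => [Y| |] // y0 aey; last by rewrite leey.
apply/ess_supP.
pose L t := line_abs (mean_poly n./2 s1) (mean_poly n./2 s2) t.
have good : \forall r \ae mu, (0 < r)%R -> (ind1 r * L r)%:E <= Y%:E.
  apply: ae_mono (ae_sphere aey) => r /[swap] r0 /(_ r0) aer.
  rewrite {1}/ind1 indicE; case: (boolP (r \in _)) => [r1|_];
    last by rewrite mul0r.
  rewrite mul1r.
  apply: (le_trans (mean_line_abs m_gt0 _ d1 d2)).
  have -> : Y%:E = \int[lam m]_y (Y%:E * (gauss_density y)%:E).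
    rewrite ge0_integralZl//; last 2 first.
    - by apply/measurable_EFinP; exact: measurable_gauss_density.
    - by move=> t _; rewrite lee_fin gauss_density_ge0.
    by rewrite integral_gauss_density mule1.
  apply: ae_ge0_le_integral => //.
  - by move=> t _; rewrite lee_fin mulr_ge0 ?normc_ge0 ?gauss_density_ge0.
  - apply/measurable_EFinP; apply: measurable_funM;
      last exact: measurable_gauss_density.
    apply: (measurableT_comp (measurable_tuple_abs s1 s2)).
    by apply: measurable_scale_tuple => //; exact: measurable_direction.
  - by move=> t _; rewrite mule_ge0 ?lee_fin ?gauss_density_ge0.
  - by apply: measurable_funeM; apply/measurable_EFinP;
      exact: measurable_gauss_density.
  - near=> t => _; rewrite -EFinM lee_fin ler_wpM2r ?gauss_density_ge0//.
    have t0 : (0 < norm_tuple t)%R by near: t; exact: ae_sqnorm_gt0.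
    have : (ind1 (norm_tuple (scale_tuple r (direction t))) *
        tuple_abs s1 s2 (scale_tuple r (direction t)))%:E <= Y%:E by near: t.
    rewrite norm_scale_tuple ?(ltW r0)// norm_direction// mulr1.
    by rewrite {1}/ind1 indicE r1 mul1r lee_fin.
(* Negative t are covered by evenness, and t = 0 is a null set. *)
apply: ae_mono (ae_and good (ae_and (ae_opp good) (@ae_neq0 R))) => t [gt
  [gNt]].
rewrite neq_lt => /orP[t0|]; last exact: gt.
by move: gNt; rewrite oppr_gt0 t0 ind1N /L line_absN; exact.
Unshelve. all: by end_near. Qed.
End norm_comparison.

(** * Comparison of the sharp constants *)

Section radial_polynomial.
Context {R : realType} {m : nat}.
Hypothesis m_gt0 : (0 < m)%N.
Implicit Types (s : seq (R * ('I_m -> nat))) (q : {poly R}).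

Definition fradial K q : seq (R * ('I_m -> nat)) :=
  flatten [seq [seq (q`_k * u.1, u.2) | u <- frad k] | k <- index_iota 0 K.+1].

Lemma fsum_fradial phi K q :
  fsum phi (fradial K q) = \sum_(k < K.+1) q`_k * fsum phi (frad k).
Proof.
rewrite fsum_flatten big_mkord; apply: eq_bigr => k _.
rewrite /fsum big_map mulr_sumr; apply: eq_bigr => u _.
by rewrite mulrA.
Qed.

Lemma mdegree_fradial K q : all (fun u => mdegree u.2 <= 2 * K)%N (fradial K q).
Proof.
have : all (fun k => k <= K)%N (index_iota 0 K.+1).
  by apply/allP => k; rewrite mem_index_iota.
rewrite /fradial; elim: (index_iota _ _) => //= k r IH /andP[kK /IH rK].
rewrite all_cat rK andbT all_map.
by apply: sub_all (mdegree_frad k) => u /= /eqP ->; rewrite mul2n leq_double.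
Qed.

Lemma feval_fradial K q (x : 'rV[R]_m) : (size q <= K.+1)%N ->
  feval (fradial K q) x = q.[\sum_i x 0 i ^+ 2].
Proof.
move=> sq; rewrite /feval fsum_fradial (horner_coef_wide _ sq).
by apply: eq_bigr => k _; rewrite -feval_frad.
Qed.

(** The Laplacian and its radial part agree on |x|^(2k): only k = N survives at 0, and
    [fsum_gauss_frad] identifies the constant. *)
Lemma fsum_laplace_frad N k : fsum (laplace_coef N) (@frad R m k) =
  (k == N)%:R * @bessel_const R m N.
Proof.
rewrite (@eq_fsum _ _ (fun a => mdegree a == k.*2) _
  (fun a => (k == N)%:R * (4 ^+ N * N`!%:R) * monomial_gauss_moment a));
    last 2 first.
- exact: mdegree_frad.
- move=> a /eqP ak; rewrite /laplace_coef ak -!mulrA; congr (_%:R * _).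
  by congr nat_of_bool; apply/eqP/eqP => [/double_inj|->].
rewrite fsumZ fsum_gauss_frad// /bessel_const.
by case: eqVneq => [->|]; rewrite ?mul0r// !mul1r.
Qed.

Lemma fsum_laplace_fradial N K q : (size q <= K.+1)%N ->
  fsum (laplace_coef N) (fradial K q) = @bessel_const R m N * q`_N.
Proof.
move=> sq; rewrite fsum_fradial;
  under eq_bigr do rewrite fsum_laplace_frad mulrA.
rewrite -mulr_suml mulrC; congr (_ * _).
have [NK|KN] := ltnP N K.+1.
  rewrite (bigD1 (Ordinal NK))//= eqxx mulr1 big1 ?addr0// => k kN.
  have -> : (k == N :> nat) = false by apply: contraNF kN => /eqP kE;
    apply/eqP/val_inj.
  by rewrite mulr0.
rewrite nth_default ?(leq_trans sq)// big1// => k _.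
by rewrite (ltn_eqF (leq_trans (ltn_ord k) KN)) mulr0.
Qed.
End radial_polynomial.

Section ratios.
Context {R : realType}.

(** Otherwise the points (k+1)^-2 for k < size q would be too many distinct roots. Thus nonzero
    coefficients give a function that is nonzero on the domain. *)
Lemma poly_neq0_sqr (q : {poly R}) : q != 0 -> exists2 t : R, 0 < t <= 1 & q.[t
  ^+ 2] != 0.
Proof.
move=> q0; apply: contrapT => noroot.
pose rs : seq R := [seq (k.+1%:R^-1) ^+ 2 | k <- iota 0 (size q)].
suff : (size rs < size q)%N by rewrite size_map size_iota ltnn.
apply: max_poly_roots => //.
  apply/allP => _ /mapP[k _ ->]; apply/rootP/eqP; apply: contrapT => /negP qk.
  by apply: noroot; exists (k.+1%:R^-1);
    rewrite // invr_gt0 ltr0n invf_le1 ?ltr0n// ler1n.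
rewrite map_inj_uniq ?iota_uniq// => j k /eqP.
rewrite eqrXn2// ?invr_ge0// => /eqP/invr_inj/eqP.
by rewrite eqr_nat eqSS => /eqP.
Qed.

Local Open Scope ereal_scope.

(** The conventions 0^-1 = +oo and +oo^-1 = 0 cover null and infinite norms: y = 0 makes the right
    side infinite when a > 0, and x = +oo makes the left side zero. *)
Lemma ratio_le (a c : R) (x y : \bar R) : (0 <= a)%R -> (0 < c)%R ->
  0 <= x -> 0 <= y -> y <= c%:E * x -> a%:E / x <= c%:E * (a%:E / y).
Proof.
rewrite le_eqVlt => /predU1P[<-|a0] c0; first by rewrite !mul0e mule0.
case: x => [x| |]//; last first.
  move=> _ y0 _; rewrite invey mule0.
  by rewrite mule_ge0 ?lee_fin ?(ltW c0)// mule_ge0 ?lee_fin ?(ltW a0)//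
    inve_ge0.
rewrite lee_fin => x0; case: y => [y| |]//.
rewrite !lee_fin !inver => y0 yx; have [y00|yN0] := eqVneq y 0%R.
  by rewrite !gt0_muley ?lte_fin// leey.
have y1 : (0 < y)%R by rewrite lt_neqAle eq_sym yN0.
have x1 : (0 < x)%R by rewrite -(pmulr_rgt0 _ c0) (lt_le_trans y1).
rewrite gt_eqF// -!EFinM lee_fin ler_pdivrMr// mulrAC mulrA -mulrA.
by rewrite [leRHS](_ : _ = a * (c * x / y))%R ?ler_peMr ?ler_pdivlMr ?mul1r
  ?(ltW a0)//; ring.
Qed.

Lemma ratio_ge (a c : R) (x y : \bar R) : (0 <= a)%R -> (0 < c)%R ->
  0 <= x -> 0 <= y -> c%:E * x <= y -> c%:E * (a%:E / y) <= a%:E / x.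
Proof.
move=> a0 c0 x0 y0 xy.
have ci0 : (0 < c^-1)%R by rewrite invr_gt0.
have := @ratio_le a c^-1 y x a0 ci0 y0 x0 _.
move=> /(_ _)/wrap[|h].
  by rewrite -(@lee_pmul2l _ c%:E) ?lte_fin// muleA -EFinM divff ?gt_eqF//
    mul1e.
by rewrite -(@lee_pmul2l _ c^-1%:E) ?lte_fin// muleA -EFinM mulVf ?gt_eqF//
  mul1e.
Qed.
End ratios.

Section norm_bounds.
Context {R : realType} {m : nat}.
Hypothesis m_gt0 : (0 < m)%N.
Implicit Types (s : seq (R * ('I_m -> nat))) (q : {poly R}) (p : \bar R).
Local Open Scope ereal_scope.

(** The inverse of p is taken in [\bar R], so the exponent is 0 and the ratio 1 at [+oo]. *)
Definition norm_ratio p : R := ((2 / sphere_area R m) `^ fine (p^-1)%E)%R.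

Definition ball_fun s1 s2 (x : 'rV[R]_m) : R[i] := (feval s1 x +i* feval s2
  x)%C.

Definition line_fun q1 q2 (t : R) : R[i] := (even_eval q1 t +i* even_eval q2
  t)%C.

Local Notation line_norm := (@weighted_Lp_norm R (fun t => `|t| ^+ m.-1)%R
  `[(-1)%R, 1%R]).

Lemma norm_ratio_gt0 p : (0 < norm_ratio p)%R.
Proof.
by apply: powR_gt0; rewrite sphere_areaE// invrK mulr_gt0// sphere_const_gt0.
Qed.

Lemma ball_Lp_norm_ge0 p (f : 'rV[R]_m -> R[i]) : 0 <= ball_Lp_norm p f.
Proof. exact: Lnorm_ge0. Qed.

Lemma weighted_Lp_norm_ge0 p q1 q2 : 0 <= line_norm p (line_fun q1 q2).
Proof.
case: p => [p| |] //=; first exact: poweR_ge0.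
apply: ess_sup_gee; last by apply: nearW => t;
  rewrite lee_fin mulr_ge0 ?normc_ge0// indicE.
have := lebesgue_measure_itv (`]-oo, +oo[ : interval R).
rewrite /= set_itvNyy => E.
have : 0%E < +oo + +oo :> \bar R by exact: ltry.
by rewrite -E.
Qed.

Let ratio_fin (r : R) (I : \bar R) : (1 <= r)%R -> 0 <= I ->
  ((2 * sphere_const m)%:E * I) `^ r^-1 = (norm_ratio r%:E)%:E * I `^ r^-1.
Proof.
move=> r1 I0; have r0 : (r != 0)%R by rewrite gt_eqF// (lt_le_trans _ r1).
have c0 : 0 <= (2 * sphere_const m)%:E :> \bar R.
  by rewrite lee_fin mulr_ge0// ltW// sphere_const_gt0.
by rewrite (poweRM _ c0 I0) poweR_EFin /norm_ratio sphere_areaE// invrK inver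
  (negbTE r0).
Qed.

Lemma line_norm_le_ball_norm p n s1 s2 : 1 <= p ->
  all (fun u => mdegree u.2 <= n)%N s1 -> all (fun u => mdegree u.2 <= n)%N s2
    ->
  line_norm p (line_fun (mean_poly n./2 s1) (mean_poly n./2 s2)) <=
  (norm_ratio p)%:E * ball_Lp_norm p (ball_fun s1 s2).
Proof.
case: p => [r| |]// r1 d1 d2; last first.
  rewrite /norm_ratio /= powRr0 mul1e ball_Lp_norm_y//.
  exact: weighted_le_ball_y.
rewrite lee_fin in r1; rewrite ball_Lp_norm_fin// -ratio_fin//; last first.
  by apply: integral_ge0 => x _; rewrite lee_fin mulr_ge0 ?ind1_ge0 ?powR_ge0.
apply: gt0_ler_poweR.
- by rewrite invr_ge0 (le_trans _ r1).
- rewrite in_itv/= leey andbT; apply: integral_ge0 => t _.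
  by rewrite lee_fin mulr_ge0 ?powR_ge0 ?exprn_ge0.
- rewrite in_itv/= leey andbT; apply: mule_ge0.
    by rewrite lee_fin mulr_ge0// ltW// sphere_const_gt0.
  by apply: integral_ge0 => x _; rewrite lee_fin mulr_ge0 ?ind1_ge0 ?powR_ge0.
- exact: weighted_le_ball.
Qed.

Lemma ball_norm_le_line_norm p K q1 q2 : 1 <= p ->
  (size q1 <= K.+1)%N -> (size q2 <= K.+1)%N ->
  (norm_ratio p)%:E * ball_Lp_norm p (ball_fun (fradial K q1) (fradial K q2)) <=
  line_norm p (line_fun q1 q2).
Proof.
move=> + z1 z2.
have rad (x : m.-tuple (measurableTypeR R)) :
    tuple_abs (fradial K q1) (fradial K q2) x = line_abs q1 q2 (norm_tuple x).
  rewrite /tuple_abs /line_abs /even_eval sqr_norm_tuple !feval_fradial//.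
  by congr (Normc.normc (_.[_] +i* _.[_])%C); apply: eq_bigr => i _;
    rewrite mxE.
case: p => [r| |]// r1; last first.
  rewrite /norm_ratio /= powRr0 mul1e ball_Lp_norm_y//.
  exact: radial_ball_le_y.
rewrite lee_fin in r1; rewrite ball_Lp_norm_fin// -ratio_fin//; last first.
  by apply: integral_ge0 => x _; rewrite lee_fin mulr_ge0 ?ind1_ge0 ?powR_ge0.
by rewrite -(radial_ball_eq m_gt0 r rad).
Qed.

Lemma iter_laplacian_ball_fun N s1 s2 :
  iter N (@complexify R 'rV[R]_m (@laplacian R m)) (ball_fun s1 s2) 0%R =
  (fsum (laplace_coef N) s1 +i* fsum (laplace_coef N) s2)%C.
Proof. by rewrite iter_complexify -!iter_laplacian_feval0. Qed.

Lemma iter_bessel_line_fun N q1 q2 :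
  iter N (@complexify R R (@bessel R (m%:R / 2 - 1))) (line_fun q1 q2) 0%R =
  ((@bessel_const R m N * q1`_N)%R +i* (@bessel_const R m N * q2`_N)%R)%C.
Proof. by rewrite iter_complexify -!(iter_bessel_even0 _ _ m_gt0). Qed.

Lemma line_fun_neq0 q1 q2 : (q1 != 0%R) || (q2 != 0%R) ->
  exists2 t : R, (`[(-1)%R, 1%R]%classic : set R) t & line_fun q1 q2 t != 0%R.
Proof.
move=> /orP[] /poly_neq0_sqr[t /andP[t0 t1] qt]; exists t;
  rewrite /= ?in_itv/= ?t1 ?andbT//;
    try by rewrite (le_trans _ (ltW t0))// lerN10.
  by rewrite eq_complex /= negb_and qt.
by rewrite eq_complex /= negb_and qt orbT.
Qed.

Lemma ball_fun_neq0 K q1 q2 : (size q1 <= K.+1)%N -> (size q2 <= K.+1)%N ->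
  (exists2 t : R, (`[(-1)%R, 1%R]%classic : set R) t & line_fun q1 q2 t != 0%R)
    ->
  exists2 x : 'rV[R]_m, @unit_ball R m x & ball_fun (fradial K q1) (fradial K
    q2) x != 0%R.
Proof.
move=> z1 z2 [t /=]; rewrite in_itv/= => t1 ft.
(* The point t on the first axis has Euclidean norm |t|, so the radial extension takes there the
   value at t. *)
pose x : 'rV[R]_m := (t *: delta_mx 0 (Ordinal m_gt0))%R.
have xE : (\sum_i x 0 i ^+ 2 = t ^+ 2)%R.
  rewrite (bigD1 (Ordinal m_gt0))//= !mxE !eqxx mulr1 big1 ?addr0// => i ij.
  by rewrite !mxE (negbTE ij) mulr0 expr0n.
exists x; last by rewrite /ball_fun !feval_fradial// xE.
by rewrite /unit_ball/= /euclidean_norm xE sqrtr_sqr ler_norml.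
Qed.
End norm_bounds.

Theorem corollary3p9 (R : realType) (m n N : nat) (p : \bar R)
    (m_gt0 : (0 < m)%N) (n_gt0 : (0 < n)%N) (p_ge1 : (1 <= p)%E) :
  sharp_constant (@unit_ball R m) (@mpoly_funs R n m) (@ball_Lp_norm R m p)
    (iter N (@complexify R 'rV[R]_m (@laplacian R m))) (0 : 'rV[R]_m) =
  (((2 / sphere_area R m) `^ fine (p^-1)%E)%:E *
   sharp_constant (`[(-1)%R, 1%R] : set R) (@even_poly_funs R (2 * n./2)%N)
     (@weighted_Lp_norm R (fun t => `|t| ^+ m.-1)%R `[(-1)%R, 1%R] p)
     (iter N (@complexify R R (@bessel R (m%:R / 2 - 1)))) (0 : R)%R)%E.
Proof.
have c0 := norm_ratio_gt0 m_gt0 p.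
rewrite /sharp_constant -[X in X%:E]/(@norm_ratio R m p) -ereal_sup_pZl//.
set Bessel := iter N (complexify (@bessel R (m%:R / 2 - 1))).
set line_norm := weighted_Lp_norm _ _ p;
  set S := ereal_sup [set (_ * x)%E | x in _].
(* The positive factor now stands inside the supremum; each nonzero pair of admissible size is a
   competitor. *)
have line_le (q1 q2 : {poly R}) : (size q1 <= n./2.+1)%N -> (size q2 <=
  n./2.+1)%N ->
    (q1 != 0) || (q2 != 0) ->
    ((@norm_ratio R m p)%:E * ((Normc.normc (Bessel (line_fun q1 q2) 0))%:E /
      line_norm (line_fun q1 q2)) <= S)%E.
  move=> z1 z2 q0; apply: ereal_sup_ubound.
  eexists; last reflexivity.
  exists (line_fun q1 q2) => //; split; last exact: line_fun_neq0.
  by apply/even_poly_funsP; exists q1, q2.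
apply/eqP; rewrite eq_le; apply/andP; split; apply: ge_ereal_sup.
- move=> _ [f [/mpoly_funsP[s1 [s2 [d1 d2 ->]]] _] <-].
  rewrite -/(ball_fun s1 s2) iter_laplacian_ball_fun.
  rewrite (mean_poly_laplace N m_gt0 d1) (mean_poly_laplace N m_gt0 d2).
  have := line_norm_le_ball_norm m_gt0 p_ge1 d1 d2; rewrite -/line_norm.
  have := line_le (mean_poly n./2 s1) (mean_poly n./2 s2)
    (size_mean_poly _ _) (size_mean_poly _ _).
  rewrite /Bessel iter_bessel_line_fun//.
  set q1 := mean_poly n./2 s1; set q2 := mean_poly n./2 s2.
  have [q0|] := boolP ((q1 != 0) || (q2 != 0)).
    move=> /(_ isT) qS nle; apply: le_trans qS; apply: ratio_le => //.
    + exact: normc_ge0.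
    + exact: ball_Lp_norm_ge0.
    + exact: weighted_Lp_norm_ge0.
  (* The average vanishes identically, so the ratio on the ball is 0. It remains to see that the
     supremum is nonnegative, and the constant function 1 shows it. *)
  rewrite negb_or !negbK => /andP[/eqP -> /eqP ->] _ _.
  rewrite !coef0 !mulr0 Normc.normc0 mul0e.
  apply: le_trans (line_le 1 0 _ _ _);
    rewrite ?size_poly1 ?size_poly0 ?oner_eq0//.
  rewrite mule_ge0 ?lee_fin ?(ltW c0)// mule_ge0 ?lee_fin ?normc_ge0// inve_ge0.
  exact: weighted_Lp_norm_ge0.
- move=> _ [_ [F [/even_poly_funsP[q1 [q2 [z1 z2 ->]]] F0] <-] <-].
  rewrite -/(line_fun q1 q2) /Bessel iter_bessel_line_fun//.
  (* The radial extension F(|x|) keeps the operator value at 0, while its ball norm times the factor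
     is at most the norm of F. *)
  pose f : 'rV[R]_m -> R[i] := ball_fun (fradial n./2 q1) (fradial n./2 q2).
  have fN : iter N (complexify (@laplacian R m)) f 0 =
      ((@bessel_const R m N * q1`_N) +i* (@bessel_const R m N * q2`_N))%C.
    by rewrite iter_laplacian_ball_fun !fsum_laplace_fradial.
  rewrite -fN; apply: le_trans (ereal_sup_ubound _).
    apply: (@ratio_ge _ _ _ (ball_Lp_norm p f)) => //.
    + exact: normc_ge0.
    + exact: ball_Lp_norm_ge0.
    + exact: weighted_Lp_norm_ge0.
    + exact: ball_norm_le_line_norm.
  exists f => //; split; last exact: ball_fun_neq0.
  (* The extension has degree at most 2 floor(n/2), which does not exceed n. *)
  have dn q : all (fun u => mdegree u.2 <= n)%N (fradial (m := m) n./2 q).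
    apply: sub_all (mdegree_fradial n./2 q) => u /leq_trans; apply.
    by rewrite mul2n -{2}(odd_double_half n) leq_addl.
  by apply/mpoly_funsP; exists (fradial n./2 q1), (fradial n./2 q2).
Qed.
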